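(* For all positive integers $n,d,r$, $$g_{r}(n;d)=\sum_{\pi}\operatorname{sign}(\pi)\,\bigl|W'(d,2rn;T(\pi))\bigr|,$$ where the sum is over all permutations $\pi$ of $\{1,\dots,d\}$.
   Context: Graphs. Let $U=\{u_1\prec\dots\prec u_n\}$ and $V=\{v_1\prec\dots\prec v_n\}$ be disjoint totally ordered sets. An $r$-regular bipartite multi-graph on color classes $U,V$ is given by nonnegative integer edge multiplicities (an $n\times n$ matrix) such that every vertex of $U$ and of $V$ has degree $r$, counted with multiplicity. Two distinct edges $uv$ and $u'v'$ ($u,u'\in U$, $v,v'\in V$) are noncrossing if $u\prec u'$ and $v\prec v'$, or $u'\prec u$ and $v'\prec v$. A planar matching is a matching in which every two distinct edges are noncrossing. $g_r(n;d)$ is the number of $r$-regular bipartite multi-graphs on $U,V$ all of whose planar matchings have at most $d$ edges. Walks. A lattice walk in $\mathbb{Z}^d$ of length $M$ is $w_0\dots w_M$ with $\|w_i-w_{i-1}\|_1=1$; it is identified with the sequence of its steps, each step being a positive step $+\vec e_j$ or a negative step $-\vec e_j$ in some direction $j\in\{1,\dots,d\}$. For $\vec p\in\mathbb{Z}^d$, $W^*(d,M;\vec p)$ is the set of walks of length $M$ from the origin to $\vec p$ in which all positive steps precede all negative steps; such a walk is written $a_1a_2\cdots|b_1b_2\cdots$, where the $a_i\in\{1,\dots,d\}$ are the directions of the successive positive steps and the $b_j\in\{1,\dots,d\}$ the directions of the successive negative steps. For a permutation $\pi$ of $\{1,\dots,d\}$, the Toeplitz point is $T(\pi)=(1-\pi(1),\dots,d-\pi(d))$;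 a walk of length $2m$ from the origin to a Toeplitz point has $m$ positive and $m$ negative steps. With $m=rn$, $W'(d,2m;T(\pi))$ is the set of walks $a_1\cdots a_m|b_1\cdots b_m$ in $W^*(d,2m;T(\pi))$ such that $a_{r(i-1)+s}\ge a_{r(i-1)+s+1}$ and $b_{r(i-1)+s}\ge b_{r(i-1)+s+1}$ for all $1\le i\le n$ and $1\le s<r$. *)

(* Defs.v *)
From mathcomp Require Import all_boot all_order all_fingroup all_algebra.

Set Implicit Arguments.
Unset Strict Implicit.
Unset Printing Implicit Defensive.

Import GRing.Theory.

(* Both colour classes are 'I_n with its usual order, and G u v is the
   multiplicity of the edge joining the u-th vertex of the first class to the
   v-th vertex of the second. *)
Definition regular (n r : nat) (G : 'M[nat]_n) : bool :=
  [forall u : 'I_n, \sum_(v < n) G u v == r] &&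
  [forall v : 'I_n, \sum_(u < n) G u v == r].

Definition noncrossing (n : nat) (e f : 'I_n * 'I_n) : bool :=
  ((e.1 < f.1) && (e.2 < f.2)) || ((f.1 < e.1) && (f.2 < e.2)).

(* A matching contains at most one edge from each parallel class, so it is
   determined by the set of pairs of end vertices of its edges. *)
Definition matching (n : nat) (G : 'M[nat]_n) (S : {set 'I_n * 'I_n}) : bool :=
  [forall e in S, 0 < G e.1 e.2] &&
  [forall e in S, forall f in S,
     (e != f) ==> (e.1 != f.1) && (e.2 != f.2)].

Definition planar_matching (n : nat) (G : 'M[nat]_n)
    (S : {set 'I_n * 'I_n}) : bool :=
  matching G S &&
  [forall e in S, forall f in S, (e != f) ==> noncrossing e f].

Definition planar_matchings_le (n d : nat) (G : 'M[nat]_n) : bool :=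
  [forall S : {set 'I_n * 'I_n}, planar_matching G S ==> (#|S| <= d)].

Lemma regular_le (n r : nat) (G : 'M[nat]_n) (u v : 'I_n) :
  regular r G -> G u v <= r.
Proof.
case/andP => /forallP/(_ u)/eqP <- _.
by rewrite (bigD1 v) //= leq_addr.
Qed.

(* By regular_le, restricting the multiplicities to {0, ..., r} loses no
   r-regular multigraph; it only makes the set being counted finite. *)
Definition g (r n d : nat) : nat :=
  #|[set G : 'M['I_r.+1]_n |
      let G' := map_mx (@nat_of_ord r.+1) G in
      regular r G' && planar_matchings_le d G']|.

(* (true, j) is the step +e_j and (false, j) is the step -e_j.  Directions are
   numbered from 0, which changes neither their order nor the differences
   i - pi(i). *)
Definition step (d : nat) : Type := (bool * 'I_d)%type.

Definition step_vec (d : nat) (s : step d) : 'rV[int]_d :=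
  (if s.1 then delta_mx ord0 s.2 else - delta_mx ord0 s.2)%R.

Definition endpoint (d M : nat) (w : M.-tuple (step d)) : 'rV[int]_d :=
  (\sum_(i < M) step_vec (tnth w i))%R.

Definition Wstar (d M : nat) (p : 'rV[int]_d) : {set M.-tuple (bool * 'I_d)} :=
  [set w : M.-tuple (bool * 'I_d) |
    (endpoint w == p) &&
    [forall i : 'I_M, forall j : 'I_M,
       (i < j) ==> (tnth w j).1 ==> (tnth w i).1]].

Definition pos_dirs (d : nat) (w : seq (step d)) : seq nat :=
  [seq nat_of_ord s.2 | s <- w & s.1].

Definition neg_dirs (d : nat) (w : seq (step d)) : seq nat :=
  [seq nat_of_ord s.2 | s <- w & ~~ s.1].

Definition block_decreasing (r n : nat) (a : seq nat) : bool :=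
  [forall i : 'I_n, forall s : 'I_r,
     (s.+1 < r) ==> (nth 0 a (r * i + s).+1 <= nth 0 a (r * i + s))].

Definition toeplitz (d : nat) (pi : 'S_d) : 'rV[int]_d :=
  (\row_(i < d) ((nat_of_ord i)%:Z - (nat_of_ord (pi i))%:Z))%R.

(* The coordinates of toeplitz pi sum to 0, so these walks have exactly r * n
   steps of each sign and the default value of nth is never reached. *)
Definition Wprime (d r n : nat) (pi : 'S_d) :
    {set (2 * (r * n)).-tuple (bool * 'I_d)} :=
  [set w in @Wstar d (2 * (r * n)) (toeplitz pi) |
    block_decreasing r n (pos_dirs w) && block_decreasing r n (neg_dirs w)].

(* Main.v *)
Require Import Defs.
From mathcomp Require Import all_boot all_order all_fingroup all_algebra.
From mathcomp Require Import zify.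

Set Implicit Arguments.
Unset Strict Implicit.
Unset Printing Implicit Defensive.

Import GRing.Theory.

(** Both sides of the identity count pairs of Young tableaux.

    Multigraphs.  A multigraph is a matrix of multiplicities, and the largest
    planar matching in its first i rows and j columns is a longest chain of
    nonzero entries that increases strictly in both coordinates.  The Burge
    variant of the Robinson-Schensted-Knuth correspondence turns the matrix
    into a growth diagram: a partition at every corner (i, j) of the grid,
    neighbouring partitions differing by horizontal strips, and the number of
    rows of the partition at (i, j) being exactly that longest chain
    ([growth_chain_length]).  Around each cell of the grid the local rule can be
    run forwards, from three partitions and the entry to the fourth partition,
    and backwards, from three partitions to the fourth one and the entry
    ([burge_step_backward]).  So the r-regular multigraphs with planar matchings
    of at most d edges correspond to pairs of chains of partitions with at most
    d rows, growing by horizontal strips of size r and ending at the same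
    partition, read on the right and on the upper boundary of the diagram.
    Adding the staircase d-1, ..., 1, 0 turns such a chain into a path of d
    walkers that keep strictly decreasing positions and interlace at each step;
    writing K(x) for the number of such paths from the staircase to x, the
    number of multigraphs is the sum of K(x)^2 ([g_npaths]).

    Walks.  A block of r weakly decreasing directions is determined by how
    often each direction occurs, so the words a and b are paths of d
    walkers that make r unit moves in each of n rounds with no interlacing
    condition.  If N(y, x) counts these free paths and D denotes the staircase,
    the walks to the Toeplitz point of pi number the sum over x of
    N(D, x) N(D o pi, x) ([card_Wprime_paths]): after the positive part the
    walkers are at x, and undoing the negative part must lead them to D o pi.

    Reflection.  Put S(x) = sum over pi of sign(pi) N(D o pi, x).  This function
    is antisymmetric under permutations of the coordinates.  On decreasing x it
    equals K(x) ([signed_paths_interlaced]), because in the recursion for S the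
    predecessors that violate interlacing cancel in pairs exchanged by swapping
    two adjacent walkers.  The signed sum of walks is the sum of N(D, x) S(x);
    grouping the x by orbits of the symmetric group and using antisymmetry
    gives the sum of S(x)^2 over decreasing x ([sum_signed_paths]), which is
    the sum of K(x)^2 again. *)

(** * Sums over words and counts of paths *)

Lemma sum_tuple_cons (T : finType) (n : nat) (F : seq T -> nat) :
  \sum_(t : n.+1.-tuple T) F t = \sum_(x : T) \sum_(t : n.-tuple T) F (x :: t).
Proof.
rewrite pair_big /=.
rewrite (reindex (fun p : T * n.-tuple T => [tuple of p.1 :: p.2])) //=.
exists (fun t : n.+1.-tuple T => (thead t, [tuple of behead t])) => /=.
  by case=> x t _ /=; congr pair; apply: val_inj.
by move=> t _; rewrite [RHS]tuple_eta.
Qed.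

Lemma sum_tuple_cat (T : finType) (p q N : nat) (F : seq T -> nat) :
  N = p + q ->
  \sum_(t : N.-tuple T) F t =
    \sum_(u : p.-tuple T) \sum_(v : q.-tuple T) F (u ++ v).
Proof.
move=> ->; elim: p F => [|p IH] F.
  rewrite [RHS](big_pred1 [tuple]) //= => u.
  by apply/esym/eqP; exact: tuple0.
rewrite -[_ + _]/((p + q).+1) sum_tuple_cons.
rewrite (sum_tuple_cons _ (fun u => \sum_(v : q.-tuple T) F (u ++ v))).
by apply: eq_bigr => x _; exact: (IH (fun s => F (x :: s))).
Qed.

(** The recursion peels off the first step; [npathsSr] peels off the last one, and [npaths_card] counts the same
    paths as tuples of visited points. *)
Fixpoint npaths (T : finType) (e : rel T) (n : nat) (x y : T) : nat :=
  if n is n'.+1 then \sum_(z | e x z) npaths e n' z y else (x == y).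

Lemma npathsSr (T : finType) (e : rel T) (n : nat) (x y : T) :
  npaths e n.+1 x y = \sum_(z | e z y) npaths e n x z.
Proof.
elim: n x => [|n IH] x.
  rewrite /=.
  rewrite big_mkcond [RHS]big_mkcond /=.
  rewrite (bigD1 y) //= big1 => [|z /negPf ->]; last by case: ifP.
  rewrite [RHS](bigD1 x) //= big1 => [|z]; first by rewrite !eqxx.
  by rewrite eq_sym => /negPf ->; case: ifP.
transitivity (\sum_(z | e x z) \sum_(w | e w y) npaths e n z w).
  by apply: eq_bigr => z _; rewrite -IH.
by rewrite exchange_big.
Qed.

Lemma npaths_card (T : finType) (e : rel T) (n : nat) (x y : T) :
  npaths e n x y =
    #|[set t : n.-tuple T | path e x t && (last x t == y)]|.
Proof.
have -> : #|[set t : n.-tuple T | path e x t && (last x t == y)]| =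
    \sum_(t : n.-tuple T) (path e x t && (last x t == y) : nat).
  rewrite -sum1_card big_mkcond /=; apply: eq_bigr => t _.
  by rewrite inE; case: ifP.
elim: n x => [|n IH] x /=.
  rewrite (big_pred1 [tuple]) // => u.
  by apply/esym/eqP; exact: tuple0.
rewrite (sum_tuple_cons _ (fun t : seq T => path e x t && (last x t == y) : nat)).
rewrite big_mkcond /=; apply: eq_bigr => z _.
case: ifP => _; last by rewrite big1.
by rewrite IH.
Qed.

(** * Configurations of d walkers and the reflection argument *)

(** Positions of d walkers.  The bound B makes sums over all positions finite; with
    d + r n <= B no walker starting from the staircase reaches it in n rounds. *)
Definition config (d B : nat) : Type := {ffun 'I_d -> 'I_B.+1}.

Definition permute (d B : nat) (x : config d B) (s : 'S_d) : config d B :=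
  [ffun i => x (s i)].

Definition decreasing (d B : nat) (x : config d B) : bool :=
  [forall i : 'I_d, forall j : 'I_d, (i < j) ==> (x j < x i)].

Definition dominated (r d B : nat) (z x : config d B) : bool :=
  [forall i : 'I_d, z i <= x i] && (\sum_i (x i : nat) == \sum_i (z i : nat) + r).

(** The first k of the d-1 interlacing inequalities.  They are imposed one at a
    time in the reflection argument, so that each round of cancellation knows
    which inequality is the first one to fail. *)
Definition interlaced_upto (k d B : nat) (z x : config d B) : bool :=
  [forall i : 'I_d, forall j : 'I_d,
     ((j == i.+1 :> nat) && (i < k)) ==> (x j < z i)].

Definition interlaced (r d B : nat) (z x : config d B) : bool :=
  dominated r z x && interlaced_upto d z x.

Definition staircase (d B : nat) : config d B :=
  [ffun i : 'I_d => inord (d.-1 - i)].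

Definition signed_paths (r n d B : nat) (x : config d B) : int :=
  (\sum_(s : 'S_d) (-1) ^+ odd_perm s *
     (npaths (@dominated r d B) n (permute (staircase d B) s) x)%:Z)%R.

Lemma permuteM (d B : nat) (x : config d B) (s t : 'S_d) :
  permute (permute x s) t = permute x (t * s)%g.
Proof. by apply/ffunP => i; rewrite !ffunE permM. Qed.

Lemma permute1 (d B : nat) (x : config d B) : permute x 1%g = x.
Proof. by apply/ffunP => i; rewrite !ffunE perm1. Qed.

Lemma permute_inj (d B : nat) (s : 'S_d) :
  injective (fun x : config d B => permute x s).
Proof.
move=> x y /(congr1 (fun z => permute z s^-1%g)).
by rewrite !permuteM mulVg !permute1.
Qed.

Lemma sum_permute (d B : nat) (x : config d B) (s : 'S_d) :
  \sum_i (permute x s i : nat) = \sum_i (x i : nat).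
Proof.
rewrite [RHS](reindex_inj (@perm_inj _ s)) /=.
by apply: eq_bigr => i _; rewrite ffunE.
Qed.

Lemma dominated_permute (r d B : nat) (z x : config d B) (s : 'S_d) :
  dominated r (permute z s) (permute x s) = dominated r z x.
Proof.
rewrite /dominated !sum_permute; congr andb.
apply/forallP/forallP => H i; last by rewrite !ffunE.
by have := H (s^-1%g i); rewrite !ffunE permKV.
Qed.

Lemma npaths_dominated_permute (r n d B : nat) (z x : config d B) (s : 'S_d) :
  npaths (@dominated r d B) n (permute z s) (permute x s) =
  npaths (@dominated r d B) n z x.
Proof.
elim: n z => [|n IH] z /=; first by rewrite (inj_eq (@permute_inj d B s)).
rewrite (reindex_inj (@permute_inj d B s)) /=.
by apply: eq_big => [w|w _]; rewrite ?dominated_permute ?IH.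
Qed.

Lemma signed_paths_permute (r n d B : nat) (x : config d B) (t : 'S_d) :
  signed_paths r n (permute x t) = ((-1) ^+ odd_perm t * signed_paths r n x)%R.
Proof.
rewrite /signed_paths (reindex_inj (mulgI t)) /= big_distrr /=.
apply: eq_bigr => s _.
by rewrite -permuteM npaths_dominated_permute odd_permM signr_addb mulrA.
Qed.

(** Reflection does not interfere with taking one more free step: the signed
    count obeys the same recursion as each of the counts it combines. *)
Lemma signed_pathsS (r n d B : nat) (x : config d B) :
  signed_paths r n.+1 x =
  (\sum_(z : config d B | dominated r z x) signed_paths r n z)%R.
Proof.
rewrite /signed_paths exchange_big; apply: eq_bigr => s _.
rewrite npathsSr -big_distrr /=; congr (_ * _)%R.
by rewrite (big_morph _ PoszD (erefl _)).
Qed.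

Lemma signed_paths_swap (r n d B : nat) (x : config d B) (i j : 'I_d) :
  i != j -> signed_paths r n (permute x (tperm i j)) = (- signed_paths r n x)%R.
Proof. by move=> ij; rewrite signed_paths_permute odd_tperm ij expr1 mulN1r. Qed.

(** Swapping two walkers at the same place fixes the configuration and changes
    the sign. *)
Lemma signed_paths_noninjective (r n d B : nat) (x : config d B) :
  ~~ injectiveb x -> signed_paths r n x = 0%R.
Proof.
case/injectivePn => i [j ij xij].
have e : permute x (tperm i j) = x.
  by apply/ffunP => k; rewrite ffunE; case: tpermP => [->|->|].
have := @signed_paths_swap r n d B x i j ij; rewrite e.
by set a := signed_paths _ _ _; lia.
Qed.

Lemma interlaced_upto_big (k d B : nat) (z x : config d B) :
  d <= k.+1 -> interlaced_upto k.+1 z x = interlaced_upto k z x.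
Proof.
move=> dk; apply/forallP/forallP => H i; apply/forallP => j; apply/implyP => ij.
  by have /forallP/(_ j)/implyP := H i; apply; have := ltn_ord j; lia.
by have /forallP/(_ j)/implyP := H i; apply; have := ltn_ord j; lia.
Qed.

Lemma interlaced_uptoS (k d B : nat) (z x : config d B) (i j : 'I_d) :
  k = i -> j = i.+1 :> nat ->
  interlaced_upto k.+1 z x = interlaced_upto k z x && (x j < z i).
Proof.
move=> -> ji; apply/forallP/andP => [H|[/forallP H xz] i'].
  split.
    apply/forallP => i'; apply/forallP => j'; apply/implyP => ij.
    by have /forallP/(_ j')/implyP := H i'; apply; lia.
  by have /forallP/(_ j)/implyP := H i; apply; lia.
apply/forallP => j'; apply/implyP => ij.
have [e|ne] := eqVneq i' i.
  by have -> : j' = j; [apply: val_inj => /=; move: ij; rewrite e; lia|rewrite e].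
have /forallP/(_ j')/implyP := H i'; apply.
by move: ne; rewrite -val_eqE /=; lia.
Qed.

(** Reflection at one wall.  Among the predecessors z for which the first k
    inequalities hold, those violating the next one have both z k and z k.+1 at
    most x k.+1.  Swapping these two coordinates keeps z below x, keeps the total
    and the earlier inequalities, keeps the violation, and changes the sign of
    the signed count, so these terms cancel. *)
Lemma sum_interlaced_uptoS (r n k d B : nat) (x : config d B) :
  decreasing x ->
  (\sum_(z : config d B | dominated r z x && interlaced_upto k z x)
     signed_paths r n z =
   \sum_(z : config d B | dominated r z x && interlaced_upto k.+1 z x)
     signed_paths r n z)%R.
Proof.
move=> xdec; have [dk|kd] := leqP d k.+1.
  by apply: eq_bigl => z; rewrite interlaced_upto_big.
pose i := Ordinal (ltnW kd); pose j := Ordinal kd.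
have ij : i != j by rewrite -val_eqE /=; lia.
have xji : x j < x i by have /forallP/(_ i)/forallP/(_ j)/implyP := xdec; apply.
rewrite (bigID (fun z : config d B => x j < z i)) /=.
rewrite [X in (_ + X)%R](_ : _ = 0%R) ?addr0.
  by apply: eq_bigl => z; rewrite -andbA -(@interlaced_uptoS k _ _ z x i j).
pose t := tperm i j.
pose Q (z : config d B) :=
  dominated r z x && interlaced_upto k z x && ~~ (x j < z i).
rewrite -[LHS]/(\sum_(z | Q z) signed_paths r n z)%R.
have tinv z : permute (permute z t) t = z by rewrite permuteM tperm2 permute1.
have Qt z : Q z -> Q (permute z t).
  case/andP=> /andP[/andP[/forallP zx zs] /forallP zk] zi.
  apply/andP; split; last by rewrite ffunE tpermL -leqNgt; exact: zx.
  rewrite -leqNgt in zi; apply/andP; split.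
    rewrite /dominated sum_permute zs andbT; apply/forallP => l.
    rewrite ffunE; case: tpermP => [->|->|_ _] //.
    exact: leq_trans (zx j) (ltnW xji).
  apply/forallP => i'; apply/forallP => j'; apply/implyP => h.
  have /forallP/(_ j')/implyP := zk i' => /(_ h).
  by rewrite ffunE tpermD // -val_eqE /=; lia.
have e : (\sum_(z | Q z) signed_paths r n z =
          - \sum_(z | Q z) signed_paths r n z)%R.
  rewrite {1}(reindex_inj (@permute_inj d B t)) /= -sumrN.
  apply: eq_big => [z|z _]; last exact: signed_paths_swap.
  by apply/idP/idP => [/Qt|/Qt //]; rewrite tinv.
by move: e; set a := (\sum_(z | _) _)%R; lia.
Qed.

Lemma monotone_perm1 (d : nat) (s : 'S_d) :
  (forall i j : 'I_d, i < j -> s i < s j) -> s = 1%g.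
Proof.
(* A strictly increasing map satisfies k <= t k; apply this to s and its inverse. *)
have ge (t : 'S_d) : (forall i j : 'I_d, i < j -> t i < t j) ->
    forall k (i : 'I_d), i = k :> nat -> k <= t i.
  move=> tm; elim=> [//|k IH] i ik.
  have kd : k < d by have := ltn_ord i; lia.
  have := IH (Ordinal kd) erefl; have := tm (Ordinal kd) i; rewrite ik /=; lia.
move=> sm; apply/permP => i; rewrite perm1; apply: val_inj => /=.
have sVm (k l : 'I_d) : k < l -> s^-1%g k < s^-1%g l.
  move=> kl; case: ltngtP => // [lt|e].
    by have := sm _ _ lt; rewrite !permKV; lia.
  by move: kl; rewrite -(permKV s k) -(permKV s l) (val_inj e) ltnn.
have := ge _ sm _ i erefl; have := ge _ sVm _ (s i) erefl; rewrite permK; lia.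
Qed.

(** Only the identity preserves strict order, so an orbit of the symmetric group
    contains at most one decreasing configuration, and each rearrangement of it
    comes from a single permutation. *)
Lemma decreasing_permute1 (d B : nat) (x : config d B) (s : 'S_d) :
  decreasing x -> decreasing (permute x s) -> s = 1%g.
Proof.
move=> xd xsd; apply: monotone_perm1 => i j ij.
have /forallP/(_ i)/forallP/(_ j)/implyP/(_ ij) := xsd; rewrite !ffunE => lt.
case: ltngtP => // [ji|/val_inj e]; last by rewrite e ltnn in lt.
by have /forallP/(_ _)/forallP/(_ _)/implyP/(_ ji) := xd; lia.
Qed.

Lemma staircaseE (d B : nat) (i : 'I_d) : d <= B -> staircase d B i = d.-1 - i :> nat.
Proof. by move=> dB; rewrite ffunE inordK //; lia. Qed.

Lemma staircase_decreasing (d B : nat) : d <= B -> decreasing (staircase d B).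
Proof.
move=> dB; apply/forallP => i; apply/forallP => j; apply/implyP.
rewrite !staircaseE //; have := ltn_ord j; lia.
Qed.

(** Interlacing separates the walkers of z by those of x, so it transfers strict
    order backwards along a path. *)
Lemma interlaced_decreasing (r d B : nat) (z x : config d B) :
  interlaced r z x -> decreasing x -> decreasing z.
Proof.
case/andP=> /andP[/forallP zx _] /forallP zi /forallP xd.
apply/forallP => i; apply/forallP => j; apply/implyP => ij.
have id : i.+1 < d by have := ltn_ord j; lia.
have /forallP/(_ (Ordinal id))/implyP := zi i; rewrite /= eqxx ltn_ord => /(_ erefl) h.
apply: leq_ltn_trans (zx j) _.
have [e|ne] := eqVneq (Ordinal id) j; first by rewrite -e.
apply: ltn_trans h.
have /forallP/(_ j)/implyP := xd (Ordinal id); apply.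
by move: ne; rewrite -val_eqE /=; lia.
Qed.

(** By induction on n: imposing all interlacing inequalities on the last step
    loses nothing in the signed count, and afterwards only decreasing
    predecessors remain.  For n = 0 the only decreasing rearrangement of the
    staircase is the staircase itself. *)
Lemma signed_paths_interlaced (r n d B : nat) (x : config d B) :
  d <= B -> decreasing x ->
  signed_paths r n x = (npaths (@interlaced r d B) n (staircase d B) x)%:Z%R.
Proof.
move=> dB; elim: n x => [|n IH] x xd.
  rewrite /signed_paths (bigD1 1%g) //= odd_perm1 expr0 mul1r permute1.
  rewrite big1 ?addr0 // => s s1.
  case: eqP => [e|_]; last by rewrite mulr0.
  move: xd; rewrite -e => /(decreasing_permute1 (staircase_decreasing dB)) s1'.
  by rewrite s1' eqxx in s1.
rewrite signed_pathsS npathsSr (big_morph _ PoszD (erefl _)).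
transitivity (\sum_(z : config d B | dominated r z x && interlaced_upto d z x)
     signed_paths r n z)%R.
  have step k : (\sum_(z : config d B | dominated r z x) signed_paths r n z =
    \sum_(z : config d B | dominated r z x && interlaced_upto k z x)
     signed_paths r n z)%R.
    elim: k => [|k ->]; last exact: sum_interlaced_uptoS.
    apply: eq_bigl => z; rewrite andb_idr // => _.
    by apply/forallP => i; apply/forallP => j; rewrite andbF.
  exact: step.
by apply: eq_bigr => z zx; rewrite IH // (interlaced_decreasing zx).
Qed.

Lemma interlaced_decreasing_next (r d B : nat) (z x : config d B) :
  interlaced r z x -> decreasing x.
Proof.
case/andP=> /andP[/forallP zx _] /forallP zi.
have step (i : 'I_d) k (j : 'I_d) : j = (i + k).+1 :> nat -> x j < x i.
  elim: k j => [|k IH] j jk.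
    have /forallP/(_ j)/implyP := zi i.
    by rewrite ltn_ord jk addn0 eqxx => /(_ erefl) /leq_trans; apply.
  have kd : (i + k).+1 < d by have := ltn_ord j; lia.
  have := IH (Ordinal kd) erefl; apply: ltn_trans.
  have /forallP/(_ j)/implyP := zi (Ordinal kd).
  by rewrite ltn_ord jk /= addnS eqxx => /(_ erefl) /leq_trans; apply.
apply/forallP => i; apply/forallP => j; apply/implyP => ij.
by apply: (step i (j - i).-1); lia.
Qed.

Lemma npaths_interlaced_decreasing (r n d B : nat) (x : config d B) :
  d <= B -> npaths (@interlaced r d B) n (staircase d B) x != 0 -> decreasing x.
Proof.
move=> dB; case: n => [|n] /=.
  by case: (staircase d B =P x) => [<- _|//]; exact: staircase_decreasing.
rewrite -/(npaths _ n.+1 _ _) npathsSr sum_nat_eq0 negb_forall => /existsP [z].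
by rewrite negb_imply => /andP[/interlaced_decreasing_next].
Qed.

Lemma exists_decreasing_permute (d B : nat) (x : config d B) :
  injectiveb x -> exists s : 'S_d, decreasing (permute x s).
Proof.
move/injectiveP => xinj.
pose ge := fun a b : 'I_B.+1 => b <= a.
pose t := [tuple x i | i < d].
have /tuple_permP [s sE] : perm_eq (sort ge t) t by rewrite perm_sort.
exists s; apply/forallP => i; apply/forallP => j; apply/implyP => ij.
have so : sorted ge (sort ge t) by apply: sort_sorted => a b; exact: leq_total.
have tr : transitive ge by move=> a b c ba cb; exact: leq_trans cb ba.
have := sorted_ltn_nth tr (x i) so.
move=> /(_ i j); rewrite !inE size_sort size_tuple !ltn_ord => /(_ erefl erefl ij).
rewrite sE !nth_mktuple !tnth_mktuple !ffunE /ge leq_eqVlt.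
case/orP => [/eqP/val_inj/xinj/perm_inj e|//].
by rewrite e ltnn in ij.
Qed.

(** Each injective configuration is a unique rearrangement of a unique
    decreasing one. *)
Lemma sum_injective_configs (d B : nat) (F : config d B -> int) :
  (forall x : config d B, ~~ injectiveb x -> F x = 0%R) ->
  (\sum_x F x =
   \sum_(y : config d B | decreasing y) \sum_(s : 'S_d) F (permute y s))%R.
Proof.
move=> F0; rewrite pair_big_dep /=.
pose D := [set p : config d B * 'S_d | decreasing p.1].
rewrite (eq_bigl (mem D)) => [|p]; last by rewrite !inE andbT.
rewrite -(big_imset F (h := fun p => permute p.1 p.2)) /=; last first.
  move=> [y s] [z t]; rewrite !inE /= => yd zd e.
  have yE : y = permute z (s^-1 * t)%g.
    by rewrite -permuteM -e permuteM mulVg permute1.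
  have st1 : (s^-1 * t)%g = 1%g by apply: (decreasing_permute1 zd); rewrite -yE.
  by rewrite yE st1 permute1; congr pair; rewrite -[LHS]mulg1 -st1 mulKVg.
rewrite [RHS]big_mkcond /=; apply: eq_bigr => x _.
case: ifPn => // /imsetP nx; apply: F0; apply/negP => /exists_decreasing_permute [s xs].
case: nx; exists (permute x s, s^-1%g); first by rewrite inE.
by rewrite /= permuteM mulVg permute1.
Qed.

(** In the orbit of a decreasing y, antisymmetry factors out S(y); what is left,
    the signed sum of the N(D, y o s) = N(D o s^-1, y), is S(y) once more. *)
Lemma sum_signed_paths (r n d B : nat) :
  d <= B ->
  (\sum_(x : config d B)
     (npaths (@dominated r d B) n (staircase d B) x)%:Z * signed_paths r n x =
   (\sum_(x : config d B) npaths (@interlaced r d B) n (staircase d B) x ^ 2)%N%:Z)%R.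
Proof.
move=> dB; rewrite sum_injective_configs => [|x /signed_paths_noninjective ->]; last first.
  by rewrite mulr0.
rewrite (big_morph _ PoszD (erefl _)) [RHS](bigID (@decreasing d B)) /=.
rewrite [X in (_ + X)%R]big1 ?addr0 => [|x xd]; last first.
  case: eqVneq (@npaths_interlaced_decreasing r n d B x dB) => [-> //|_ /(_ erefl) h].
  by rewrite h in xd.
apply: eq_bigr => y yd.
rewrite -mulnn PoszM -!(signed_paths_interlaced r n dB yd).
rewrite [X in _ = (X * _)%R]/signed_paths big_distrl /= (reindex_inj invg_inj) /=; apply: eq_bigr => s _.
rewrite signed_paths_permute odd_permV mulrA; congr (_ * _)%R.
rewrite mulrC; congr (_ * (_)%:Z)%R.
by rewrite -[in LHS](npaths_dominated_permute _ _ _ _ s) permuteM mulgV permute1.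
Qed.

(** * Block-decreasing words and walks *)

Lemma block_decreasing_cat (r n : nat) (u a : seq nat) :
  size u = r ->
  block_decreasing r n.+1 (u ++ a) = sorted geq u && block_decreasing r n a.
Proof.
move=> ur; have nthu i s : nth 0 (u ++ a) (r * i.+1 + s) = nth 0 a (r * i + s).
  rewrite nth_cat ur ltnNge mulnS -addnA leq_addr /=; congr nth; lia.
have tr : transitive geq by move=> p q t /= qp pt; exact: leq_trans pt qp.
apply/forallP/andP => [H|[su /forallP H] i].
  split.
    apply/(sortedP 0) => k; rewrite ur => kr.
    have /forallP/(_ (Ordinal (ltnW kr)))/implyP/(_ kr) := H ord0.
    by rewrite /= muln0 add0n !nth_cat ur kr (ltnW kr).
  apply/forallP => i; apply/forallP => s; apply/implyP => sr.
  have /forallP/(_ s)/implyP/(_ sr) := H (lift ord0 i).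
  by rewrite lift0 -!addnS !nthu.
apply/forallP => s; apply/implyP => sr.
case: (unliftP ord0 i) => [i'|] ->.
  rewrite lift0 -!addnS !nthu addnS.
  by have /forallP/(_ s)/implyP/(_ sr) := H i'.
rewrite /= muln0 add0n !nth_cat ur sr (ltnW sr).
by have /(sortedP 0)/(_ s) := su; rewrite ur; apply.
Qed.

Lemma sum_count_mem (T : finType) (s : seq T) :
  \sum_(x : T) count_mem x s = size s.
Proof.
elim: s => [|y s IH] /=; first by rewrite big1.
rewrite big_split /= IH (bigD1 y) //= eqxx big1 => [|x]; first by rewrite addn0.
by rewrite eq_sym => /negPf ->.
Qed.

(** A decreasing block is determined by the multiplicities of its letters, and
    every vector of multiplicities of total r occurs: the block is obtained by
    sorting any word with these multiplicities. *)
Lemma sum_sorted_words (r d B : nat) (y z : config d B) :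
  \sum_(u : r.-tuple 'I_d)
    (sorted geq (map val u) && [forall j, y j + count_mem j u == z j]) =
  dominated r y z.
Proof.
have trg : transitive (relpre (@nat_of_ord d) geq).
  by move=> p q t /= qp pt; exact: leq_trans pt qp.
have asg : antisymmetric (relpre (@nat_of_ord d) geq).
  by move=> p q /= pq; apply: val_inj => /=; lia.
(* The word with the multiplicities forced by y and z, in decreasing order. *)
pose w := sort (relpre (@nat_of_ord d) geq)
            (flatten [seq nseq (z j - y j) j | j <- enum 'I_d]).
have wc j : count_mem j w = z j - y j.
  rewrite count_sort count_flatten -map_comp sumnE big_map big_enum /=.
  rewrite (bigD1 j) //= count_nseq /= eqxx mul1n big1 ?addn0 // => k kj.
  by rewrite count_nseq /= (negPf kj).
case: (boolP (dominated r y z)) => [/andP[/forallP yz /eqP s]|nyz]; last first.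
  rewrite big1 // => u _; case: andP => // -[_ /forallP uc]; case/negP: nyz.
  apply/andP; split; first by apply/forallP => j; have := uc j; lia.
  rewrite -(eq_bigr _ (fun j _ => eqP (uc j))) big_split /=.
  by rewrite sum_count_mem size_tuple.
have ws : size w == r.
  rewrite -sum_count_mem -(eqn_add2l (\sum_i (y i : nat))) -s -big_split /=.
  by apply/eqP/eq_bigr => j _; rewrite wc subnKC.
rewrite (bigD1 (Tuple ws)) //= big1 => [|u uw].
  rewrite sorted_map sort_sorted => [|p q]; last exact: leq_total.
  have -> // : [forall j, y j + count_mem j w == z j].
  by apply/forallP => j; rewrite wc subnKC.
case: andP => // -[us /forallP uc]; case/eqP: uw; apply: val_inj => /=.
apply: (sorted_eq trg asg); first by rewrite -sorted_map.
  by apply: sort_sorted => p q; exact: leq_total.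
by apply/allP => j _ /=; rewrite wc -(eqP (uc j)) addKn.
Qed.

(** Reading a word block by block gives the successive positions of the walkers;
    the positions after each block determine the block. *)
Lemma npaths_words (r n d B : nat) (y x : config d B) :
  npaths (@dominated r d B) n y x =
  \sum_(a : (r * n).-tuple 'I_d)
    (block_decreasing r n (map val a) && [forall j, y j + count_mem j a == x j]).
Proof.
elim: n y => [|n IH] y.
  rewrite (sum_tuple_cat (p := 0) (q := 0) (fun a : seq 'I_d =>
    (block_decreasing r 0 (map val a) && [forall j, y j + count_mem j a == x j])
      : nat)) ?muln0 //.
  have E : forall u : 0.-tuple 'I_d, u = [tuple] by exact: tuple0.
  rewrite (big_pred1 [tuple]) => [|u]; last by apply/esym/eqP.
  rewrite (big_pred1 [tuple]) => [|u]; last by apply/esym/eqP.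
  have -> : block_decreasing r 0 [seq val i | i <- [tuple] ++ [tuple of [::] : seq 'I_d]].
    by apply/forallP; case.
  congr nat_of_bool; apply/eqP/forallP => [-> j|xy]; first by rewrite /= addn0.
  by apply/ffunP => j; apply: val_inj; have := xy j; rewrite /= addn0 => /eqP.
rewrite (sum_tuple_cat (p := r) (q := r * n) (fun a : seq 'I_d =>
  (block_decreasing r n.+1 (map val a) && [forall j, y j + count_mem j a == x j])
    : nat)) ?mulnS //=.
pose U (z : config d B) (u : seq 'I_d) :=
  sorted geq (map val u) && [forall j, y j + count_mem j u == z j].
pose V (z : config d B) (a : seq 'I_d) :=
  block_decreasing r n (map val a) && [forall j, z j + count_mem j a == x j].
transitivity (\sum_(z : config d B) \sum_(u : r.-tuple 'I_d)
    \sum_(a : (r * n).-tuple 'I_d) U z u * V z a).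
  rewrite big_mkcond /=; apply: eq_bigr => z _.
  rewrite IH; under eq_bigr => u _ do rewrite -big_distrr.
  by rewrite -big_distrl /= sum_sorted_words; case: dominated; rewrite ?mul1n ?mul0n.
rewrite exchange_big; apply: eq_bigr => u _.
rewrite exchange_big; apply: eq_bigr => a _ /=.
rewrite map_cat block_decreasing_cat ?size_map ?size_tuple //.
under eq_bigr => z _ do rewrite mulnb /U /V andbACA.
case: andP => _; last by rewrite big1.
rewrite /=.
case: (boolP [forall j, y j + count_mem j (u ++ a) == x j]) => [/forallP H|/forallP H].
  (* The position after the first block; it stays in the box as it lies below x. *)
  have zb j : y j + count_mem j u < B.+1.
    by have := H j; have := ltn_ord (x j); rewrite count_cat; lia.
  pose z : config d B := [ffun j => Ordinal (zb j)].
  rewrite (bigD1 z) //= big1 ?addn0 => [|z' z'z].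
    have -> // : [forall j, y j + count_mem j u == z j] &&
                 [forall j, z j + count_mem j a == x j].
    apply/andP; split; apply/forallP => j; rewrite ffunE //=.
    by have := H j; rewrite count_cat addnA.
  case: andP => // -[/forallP yz' _]; case/eqP: z'z; apply/ffunP => j.
  by apply: val_inj; rewrite ffunE /= (eqP (yz' j)).
rewrite big1 // => z _; case: andP => // -[/forallP yz /forallP zx]; case: H => j.
by rewrite count_cat addnA (eqP (yz j)).
Qed.

Lemma endpointE (d M : nat) (w : M.-tuple (step d)) (j : 'I_d) :
  (endpoint w ord0 j = (count_mem (true, j) w)%:Z - (count_mem (false, j) w)%:Z)%R.
Proof.
rewrite /endpoint summxE -(big_tuple _ _ w xpredT (fun s => step_vec s ord0 j)) /=.
elim: (w : seq _) => [|[b k] s IH]; first by rewrite big_nil.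
rewrite big_cons IH /= /step_vec /= !xpair_eqE.
case: b => /=; rewrite !mxE eqxx /= eq_sym; case: (k == j) => /=; lia.
Qed.

Lemma filter_split_pairwise (T : Type) (p : pred T) (s : seq T) :
  pairwise (fun x y => p y ==> p x) s ->
  s = filter p s ++ filter (predC p) s.
Proof.
elim: s => [//|x s IH] /= /andP[xs /IH {1}->].
case px : (p x) => //=; have /all_filterP -> : all (predC p) s.
  by apply: sub_all xs => y; rewrite px implybF.
have -> // : filter p s = [::].
apply: size0nil; apply/eqP; rewrite size_filter -leqn0 leqNgt -has_count -all_predC.
by apply: sub_all xs => y; rewrite px implybF.
Qed.

Definition walk_of_words (d : nat) (a b : seq 'I_d) : seq (step d) :=
  map (pair true) a ++ map (pair false) b.

Lemma pos_dirs_walk (d : nat) (a b : seq 'I_d) :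
  pos_dirs (walk_of_words a b) = map val a.
Proof.
rewrite /pos_dirs filter_cat !filter_map /=.
by rewrite filter_predT filter_pred0 cats0 -map_comp.
Qed.

Lemma neg_dirs_walk (d : nat) (a b : seq 'I_d) :
  neg_dirs (walk_of_words a b) = map val b.
Proof.
rewrite /neg_dirs filter_cat !filter_map /=.
by rewrite filter_predT filter_pred0 -map_comp.
Qed.

Lemma count_pos_walk (d : nat) (a b : seq 'I_d) (j : 'I_d) :
  count_mem (true, j) (walk_of_words a b) = count_mem j a.
Proof.
rewrite count_cat !count_map -[RHS]addn0; congr addn.
by rewrite -(count_pred0 b); apply: eq_count => x; rewrite /= xpair_eqE.
Qed.

Lemma count_neg_walk (d : nat) (a b : seq 'I_d) (j : 'I_d) :
  count_mem (false, j) (walk_of_words a b) = count_mem j b.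
Proof.
rewrite count_cat !count_map -[RHS]add0n; congr addn.
by rewrite -(count_pred0 a); apply: eq_count => x; rewrite /= xpair_eqE.
Qed.

Lemma size_walk (d m : nat) (p : m.-tuple 'I_d * m.-tuple 'I_d) :
  size (walk_of_words p.1 p.2) == 2 * m.
Proof. by rewrite size_cat !size_map !size_tuple mul2n addnn. Qed.

(** The coordinates of a Toeplitz point add up to 0, so half of the steps are
    positive; they come first, hence the walk is the concatenation of its two
    words of directions. *)
Lemma walk_of_dirs (d m : nat) (w : (2 * m).-tuple (step d)) (pi : 'S_d) :
  w \in Wstar (2 * m) (toeplitz pi) ->
  exists p : m.-tuple 'I_d * m.-tuple 'I_d, w = Tuple (size_walk p).
Proof.
rewrite inE => /andP[/eqP we wo].
have wE : (w : seq _) = filter (fun s => s.1) w ++ filter (predC (fun s => s.1)) w.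
  apply: filter_split_pairwise; case: (posnP (2 * m)) => [m0|m0].
    by rewrite (size0nil (s := w)) // size_tuple.
  move: (tnth w (Ordinal m0)) => x0; apply/(pairwiseP x0) => i j; rewrite !inE size_tuple => im jm ij.
  have /forallP/(_ (Ordinal im))/forallP/(_ (Ordinal jm))/implyP/(_ ij) := wo.
  by rewrite !(tnth_nth x0).
have cnt b : \sum_(j < d) count_mem (b, j) w = count (fun s => s.1 == b) w.
  transitivity (\sum_j count_mem j (map snd (filter (fun s => s.1 == b) w))).
    apply: eq_bigr => j _; rewrite count_map count_filter; apply: eq_count => -[b' j'].
    by rewrite /= xpair_eqE andbC.
  by rewrite sum_count_mem size_map size_filter.
have eqc : (\sum_(j < d) endpoint w ord0 j = 0)%R.
  rewrite we; under eq_bigr => j _ do rewrite mxE.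
  rewrite big_split /= (reindex_inj (@perm_inj _ pi)) /= -big_split /=.
  by rewrite big1 // => j _; rewrite addrN.
have {}eqc : count (fun s => s.1 == true) w = count (fun s => s.1 == false) w.
  apply/eqP; rewrite -!cnt -eqz_nat -subr_eq0 -[X in _ == X]eqc.
  rewrite !(big_morph _ PoszD (erefl _)) -sumrB; apply/eqP/eq_bigr => j _.
  by rewrite endpointE.
have tot : count (fun s => s.1 == true) w + count (fun s => s.1 == false) w = 2 * m.
  rewrite -[RHS](size_tuple w) -(count_predC (fun s : step d => s.1 == true)).
  by congr addn; apply: eq_count => -[[] j].
have sa : size (map snd (filter (fun s => s.1) w)) == m.
  rewrite size_map size_filter.
  by rewrite (eq_count (a2 := fun s => s.1 == true)) => [|[[] ?]] //; lia.
have sb : size (map snd (filter (predC (fun s => s.1)) w)) == m.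
  rewrite size_map size_filter.
  by rewrite (eq_count (a2 := fun s => s.1 == false)) => [|[[] ?]] //; lia.
exists (Tuple sa, Tuple sb); apply: val_inj; rewrite /= [LHS]wE /walk_of_words -!map_comp.
congr cat; rewrite -[LHS]map_id; apply/eq_in_map => -[[] j];
  by rewrite mem_filter.
Qed.


Lemma walk_of_words_inj (d m : nat) :
  injective (fun p : m.-tuple 'I_d * m.-tuple 'I_d => Tuple (size_walk p)).
Proof.
move=> [a b] [a' b'] /(congr1 val) /= e; congr pair; apply: val_inj => /=.
  by have := congr1 (@pos_dirs d) e; rewrite !pos_dirs_walk; apply/inj_map/val_inj.
by have := congr1 (@neg_dirs d) e; rewrite !neg_dirs_walk; apply/inj_map/val_inj.
Qed.

Lemma walk_in_Wstar (d m : nat) (p : m.-tuple 'I_d * m.-tuple 'I_d) (pi : 'S_d) :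
  (Tuple (size_walk p) \in Wstar (2 * m) (toeplitz pi)) =
  [forall j : 'I_d, d.-1 - j + count_mem j p.1 == d.-1 - pi j + count_mem j p.2].
Proof.
rewrite inE andb_idr => [|_]; last first.
  apply/forallP => i; apply/forallP => j; apply/implyP => ij.
  have nthE k (km : k < 2 * m) :
      (tnth (Tuple (size_walk p)) (Ordinal km)).1 = (k < m).
    have dd : 'I_d.
      case: (p.1) => -[|x s] /= /eqP ss; last exact: x.
      by move: km; rewrite -ss.
    rewrite (tnth_nth (true, dd)) /= nth_cat size_map size_tuple.
    case: ltnP => h; rewrite (nth_map dd) // size_tuple //.
    by rewrite ltn_subLR // addnn -mul2n.
  case: i j ij => [i im] [j jm] ij; rewrite !nthE; apply/implyP.
  exact: ltn_trans.
apply/eqP/forallP => [e j|H].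
  have := congr1 (fun v : 'rV[int]_d => v ord0 j) e.
  rewrite endpointE !mxE count_pos_walk count_neg_walk.
  by have := ltn_ord j; have := ltn_ord (pi j); lia.
apply/matrixP => i j; rewrite ord1 endpointE !mxE count_pos_walk count_neg_walk.
by have := H j; have := ltn_ord j; have := ltn_ord (pi j); lia.
Qed.

(** The endpoint condition a_j - b_j = j - pi(j) on letter counts is moved into
    natural numbers by adding the staircase to both sides. *)
Lemma card_Wprime (r n d : nat) (pi : 'S_d) :
  #|Wprime r n pi| =
  \sum_(a : (r * n).-tuple 'I_d) \sum_(b : (r * n).-tuple 'I_d)
    [&& block_decreasing r n (map val a), block_decreasing r n (map val b) &
     [forall j : 'I_d, d.-1 - j + count_mem j a == d.-1 - pi j + count_mem j b]].
Proof.
rewrite pair_big -big_mkcond sum1_card /=.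
rewrite -(card_imset _ (@walk_of_words_inj d (r * n))).
apply: eq_card => w; rewrite inE; apply/andP/imsetP.
  case=> wW; have [p wE] := walk_of_dirs wW.
  rewrite wE walk_in_Wstar in wW; rewrite wE pos_dirs_walk neg_dirs_walk => bd.
  by exists p => //; rewrite unfold_in /= andbA bd.
case=> p pP ->; rewrite walk_in_Wstar pos_dirs_walk neg_dirs_walk.
by move: pP; rewrite unfold_in /= andbA => /andP[-> ->].
Qed.

Lemma card_Wprime_paths (r n d B : nat) (pi : 'S_d) :
  d + r * n <= B ->
  #|Wprime r n pi| =
  \sum_(x : config d B)
    npaths (@dominated r d B) n (staircase d B) x *
    npaths (@dominated r d B) n (permute (staircase d B) pi) x.
Proof.
move=> dB; have dB' : d <= B by lia.
pose U (a : seq 'I_d) (x : config d B) :=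
  block_decreasing r n (map val a) &&
  [forall j, staircase d B j + count_mem j a == x j].
pose V (b : seq 'I_d) (x : config d B) :=
  block_decreasing r n (map val b) &&
  [forall j, permute (staircase d B) pi j + count_mem j b == x j].
transitivity (\sum_(x : config d B) \sum_(a : (r * n).-tuple 'I_d)
    \sum_(b : (r * n).-tuple 'I_d) U a x * V b x); last first.
  apply: eq_bigr => x _; rewrite !npaths_words big_distrl /=.
  by apply: eq_bigr => a _; rewrite -big_distrr.
rewrite card_Wprime [RHS]exchange_big; apply: eq_bigr => a _.
rewrite [RHS]exchange_big; apply: eq_bigr => b _ /=.
rewrite andbA; under eq_bigr => x _ do rewrite mulnb /U /V andbACA.
set bd := block_decreasing _ _ _ && _; case: bd => /=; last by rewrite big1.
(* The common position after either word is read off from a. *)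
have xb j : staircase d B j + count_mem j a < B.+1.
  rewrite staircaseE //; have := count_size (pred1 j) a; rewrite size_tuple.
  by have := ltn_ord j; lia.
pose x : config d B := [ffun j => Ordinal (xb j)].
rewrite (bigD1 x) //= big1 ?addn0 => [|y yx]; last first.
  case: andP => // -[/forallP ay _]; case/eqP: yx; apply/ffunP => j.
  by apply: val_inj; rewrite ffunE /= (eqP (ay j)).
have pE j : permute (staircase d B) pi j = d.-1 - pi j :> nat.
  by rewrite ffunE staircaseE.
have xE j : x j = d.-1 - j + count_mem j a :> nat by rewrite ffunE /= staircaseE.
congr nat_of_bool; apply/forallP/andP => [H|[_ /forallP H] j]; last first.
  by have /eqP := H j; rewrite pE xE => ->.
split; apply/forallP => j; first by rewrite xE staircaseE.
by rewrite pE xE -(eqP (H j)).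
Qed.

(** * The Burge local rule *)

(** Partitions are functions giving the length of each row; together with [strip],
    which forces them to be weakly decreasing, this bounds their number of rows. *)
Definition at_most_rows (d : nat) (p : nat -> nat) : Prop := forall k, d <= k -> p k = 0.

(** q is obtained from p by adding a horizontal strip. *)
Definition strip (p q : nat -> nat) : Prop := forall k, p k <= q k /\ q k.+1 <= p k.

(** One row of the Burge local rule.  The row i of lam and the row i+1 of rho
    range over the same interval [a, b], where a is the larger of the rows i+1
    of mu and nu, and b the smaller of their rows i.  A carry c' arrives from
    below.  It lengthens row i+1 from a to p, but not beyond l; the unused part
    of the carry, together with the overlap b - l of the two strips in row i, is
    the carry c passed on to row i. *)
Definition burge_step (a b l c' p c : nat) : Prop :=
  [/\ a <= l <= b, p = minn l (a + c') & c = c' - (l - a) + (b - l)].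

(** The rule is reversible: the smaller of the carry c' and the room l - a is p - a,
    and their difference is c' - (l - a) = p + c - b, so a, b, p and c determine
    both. *)
Lemma burge_step_backward (a b l c' p c : nat) :
  burge_step a b l c' p c <->
  [/\ a <= p <= b, l = maxn p (b - c) & c' = (p - a) + (c + (p - a) - (b - a))].
Proof. by split=> -[] *; split; lia. Qed.

(** The local rule around one cell of the grid, with lam, mu, nu, rho at its four
    corners and multiplicity m.  The multiplicity enters as a carry below the
    last row d-1, and the carry leaving row 0 is added to that row, which has no
    upper bound.  That rho has at most d rows is a separate hypothesis below;
    for i = d-1 it forces m = 0 or an empty last row of lam. *)
Definition cell (d : nat) (lam mu nu : nat -> nat) (m : nat) (rho : nat -> nat) : Prop :=
  exists c : nat -> nat,
  [/\ forall i, i < d ->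
        burge_step (maxn (mu i.+1) (nu i.+1)) (minn (mu i) (nu i))
          (lam i) (c i.+1) (rho i.+1) (c i),
      c d = m & rho 0 = maxn (mu 0) (nu 0) + c 0].

Lemma cell_sym (d : nat) (lam mu nu : nat -> nat) (m : nat) (rho : nat -> nat) :
  cell d lam mu nu m rho -> cell d lam nu mu m rho.
Proof.
case=> c [cs cd r0]; exists c; split=> // [i id|]; last by rewrite maxnC.
by rewrite maxnC minnC; exact: cs.
Qed.

Lemma cell_forward_unique (d : nat) (lam mu nu rho lam' mu' nu' rho' : nat -> nat)
    (m : nat) :
  at_most_rows d rho -> at_most_rows d rho' -> lam =1 lam' -> mu =1 mu' -> nu =1 nu' ->
  cell d lam mu nu m rho -> cell d lam' mu' nu' m rho' -> rho =1 rho'.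
Proof.
move=> sr sr' el em en [c [cs cd r0]] [c' [cs' cd' r0']].
(* The carries agree, from the bottom row upwards. *)
have cE t : t <= d -> c (d - t) = c' (d - t).
  elim: t => [|t IH] td; first by rewrite subn0 cd cd'.
  have dt : d - t = (d - t.+1).+1 by lia.
  have lt : d - t.+1 < d by lia.
  have := IH (ltnW td); rewrite dt => ce.
  have [_ _ ->] := cs _ lt; have [_ _ ->] := cs' _ lt.
  by rewrite el !em !en ce.
move=> [|k]; first by rewrite r0 r0' em en; have := cE d (leqnn d); rewrite subnn => ->.
have [dk|kd] := leqP d k.+1; first by rewrite sr ?sr'.
have [_ -> _] := cs _ (ltnW kd); have [_ -> _] := cs' _ (ltnW kd).
have := cE (d - k.+1) (leq_subr _ _); rewrite subKn ?(ltnW kd) // => ->.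
by rewrite el em en.
Qed.

Lemma cell_backward_unique (d : nat) (lam mu nu rho lam' mu' nu' rho' : nat -> nat)
    (m m' : nat) :
  at_most_rows d lam -> at_most_rows d lam' -> rho =1 rho' -> mu =1 mu' -> nu =1 nu' ->
  cell d lam mu nu m rho -> cell d lam' mu' nu' m' rho' -> lam =1 lam' /\ m = m'.
Proof.
move=> sl sl' er em en [c [cs cd r0]] [c' [cs' cd' r0']].
(* The carries agree, from row 0 downwards. *)
have cE t : t <= d -> c t = c' t.
  elim: t => [|t IH] td; first by have := er 0; rewrite r0 r0' em en; lia.
  have /burge_step_backward [_ _ ->] := cs _ td.
  have /burge_step_backward [_ _ ->] := cs' _ td.
  by rewrite er !em !en IH // ltnW.
split; last by rewrite -cd -cd' cE.
move=> k; have [dk|kd] := leqP d k; first by rewrite sl ?sl'.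
have /burge_step_backward [_ -> _] := cs _ kd.
have /burge_step_backward [_ -> _] := cs' _ kd.
by rewrite er em en cE // ltnW.
Qed.

(** The carry arriving at row d - t, computed from the bottom row upwards. *)
Fixpoint forward_carry (d : nat) (lam mu nu : nat -> nat) (m t : nat) : nat :=
  if t is t'.+1 then
    let i := d - t in
    forward_carry d lam mu nu m t' - (lam i - maxn (mu i.+1) (nu i.+1)) +
      (minn (mu i) (nu i) - lam i)
  else m.

Definition forward (d : nat) (lam mu nu : nat -> nat) (m k : nat) : nat :=
  if k is k'.+1 then
    minn (lam k') (maxn (mu k) (nu k) + forward_carry d lam mu nu m (d - k))
  else maxn (mu 0) (nu 0) + forward_carry d lam mu nu m d.

(** The last hypothesis is what keeps the result within d rows: a positive entry
    creates a new row when lam already reaches row d-1. *)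
Lemma forward_cell (d : nat) (lam mu nu : nat -> nat) (m : nat) :
  0 < d -> at_most_rows d lam -> at_most_rows d mu -> at_most_rows d nu ->
  strip lam mu -> strip lam nu -> (0 < m -> lam d.-1 = 0) ->
  at_most_rows d (forward d lam mu nu m) /\ cell d lam mu nu m (forward d lam mu nu m).
Proof.
move=> d0 sl sm sn lm ln ml; split.
  case=> [|k] dk; first by lia.
  rewrite /=; have [e|ne] := eqVneq k.+1 d; last by rewrite sl ?min0n //; lia.
  rewrite e subnn sm // sn //= (_ : k = d.-1); last by lia.
  by case: (posnP m) ml => [->|_ ->] //; lia.
exists (fun i => forward_carry d lam mu nu m (d - i)).
split=> [i id||]; rewrite ?subnn ?subn0 //=.
have [[? ?] [? ?]] := (lm i, ln i).
have dE : d - i = (d - i.+1).+1 by lia.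
split=> //; first by lia.
by rewrite dE /= -dE subKn //; exact: ltnW.
Qed.

(** The carries in the opposite order, from row 0 down to the value d, which is the
    recovered multiplicity. *)
Fixpoint backward_carry (mu nu rho : nat -> nat) (i : nat) : nat :=
  if i is i'.+1 then
    let e := rho i - maxn (mu i) (nu i) in
    e + (backward_carry mu nu rho i' + e -
         (minn (mu i') (nu i') - maxn (mu i) (nu i)))
  else rho 0 - maxn (mu 0) (nu 0).

Definition backward (mu nu rho : nat -> nat) (k : nat) : nat :=
  maxn (rho k.+1) (minn (mu k) (nu k) - backward_carry mu nu rho k).

Lemma backward_cell (d : nat) (mu nu rho : nat -> nat) :
  at_most_rows d mu -> at_most_rows d nu -> at_most_rows d rho -> strip mu rho -> strip nu rho ->
  at_most_rows d (backward mu nu rho) /\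
  cell d (backward mu nu rho) mu nu (backward_carry mu nu rho d) rho.
Proof.
move=> sm sn sr mr nr; split.
  by move=> k dk; rewrite /backward sr ?sm ?sn // leqW.
exists (backward_carry mu nu rho); split=> // [i id|].
  apply/burge_step_backward; split=> //=.
  by have [[? ?] [? ?]] := (mr i, nr i); have [[? ?] [? ?]] := (mr i.+1, nr i.+1); lia.
by rewrite /=; have [[? ?] [? ?]] := (mr 0, nr 0); lia.
Qed.

Lemma cell_strips (d : nat) (lam mu nu rho : nat -> nat) (m : nat) :
  at_most_rows d lam -> at_most_rows d mu -> at_most_rows d nu -> at_most_rows d rho ->
  cell d lam mu nu m rho ->
  [/\ strip lam mu, strip lam nu, strip mu rho & strip nu rho].
Proof.
move=> sl sm sn sr [c [cs cd r0]].
have M k : k < d -> maxn (mu k) (nu k) <= rho k.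
  case: k => [|k] kd; first by rewrite r0 leq_addr.
  by have /burge_step_backward [/andP[]] := cs _ (ltnW kd).
have H k : [/\ maxn (mu k.+1) (nu k.+1) <= lam k <= minn (mu k) (nu k),
               rho k.+1 <= minn (mu k) (nu k) & maxn (mu k) (nu k) <= rho k].
  have [dk|kd] := leqP d k; first by rewrite sl ?sm ?sn ?sr // leqW.
  have /burge_step_backward [/andP[? ?] _ _] := cs _ kd; have [? _ _] := cs _ kd.
  by split=> //; exact: M.
by split=> k; have [/andP[? ?] ? ?] := H k; split; lia.
Qed.

(** Each step conserves l + p + c = a + b + c', and max + min recovers mu + nu. *)
Lemma cell_size (d : nat) (lam mu nu rho : nat -> nat) (m : nat) :
  at_most_rows d mu -> at_most_rows d nu -> at_most_rows d rho ->
  cell d lam mu nu m rho ->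
  \sum_(k < d) lam k + \sum_(k < d) rho k =
  \sum_(k < d) mu k + \sum_(k < d) nu k + m.
Proof.
move=> sm sn sr [c [cs cd r0]].
have H t : t <= d ->
    \sum_(k < t) lam k + \sum_(k < t.+1) rho k =
    \sum_(k < t) mu k + \sum_(k < t) nu k + maxn (mu t) (nu t) + c t.
  elim: t => [|t IH] td; first by rewrite !big_ord0 big_ord1 r0.
  have [/andP[? ?] ? ?] := cs _ td; have {}IH := IH (ltnW td).
  rewrite [\sum_(k < t.+1) lam k]big_ord_recr [\sum_(k < t.+2) rho k]big_ord_recr /=.
  rewrite [\sum_(k < t.+1) mu k]big_ord_recr [\sum_(k < t.+1) nu k]big_ord_recr /=.
  move: IH; move: (\sum_(k < t) lam k) (\sum_(k < t.+1) rho k).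
  by move: (\sum_(k < t) mu k) (\sum_(k < t) nu k); lia.
have := H d (leqnn d); rewrite [\sum_(k < d.+1) _]big_ord_recr /= sr // sm // sn // cd.
by rewrite max0n !addn0.
Qed.

(** The rows of mu and nu remain.  A new nonempty row k of rho must start from an
    empty row k of mu and nu; below that row nothing absorbs or adds to the
    carry, which therefore is still m, and it may lengthen row k if lam is
    nonempty in row k-1. *)
Lemma cell_positive (d : nat) (lam mu nu rho : nat -> nat) (m k : nat) :
  at_most_rows d lam -> at_most_rows d mu -> at_most_rows d nu -> at_most_rows d rho ->
  cell d lam mu nu m rho -> k <= d ->
  (0 < rho k) =
  [|| 0 < mu k, 0 < nu k | (0 < m) && ((k == 0) || (0 < lam k.-1))].
Proof.
move=> sl sm sn sr ce; have [lm ln mr nr] := cell_strips sl sm sn sr ce.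
case: ce => c [cs cd r0] kd.
(* Below the last nonempty row of mu and nu the carry is still m. *)
have H t : t <= d -> maxn (mu (d - t)) (nu (d - t)) = 0 -> c (d - t) = m.
  elim: t => [|t IH] td; first by rewrite subn0.
  have dt : d - t = (d - t.+1).+1 by lia.
  have lt : d - t.+1 < d by lia.
  have [/andP[? ?] _ ->] := cs _ lt.
  have [[? ?] [? ?]] := (lm (d - t.+1), ln (d - t.+1)).
  move=> mz; have := IH (ltnW td); rewrite dt => ->; last by lia.
  lia.
have := H (d - k) (leq_subr _ _); rewrite subKn // => ck.
case: k kd ck => [|k] kd ck; first by rewrite r0 /=; lia.
have [/andP[? ?] -> _] := cs _ kd; rewrite /=; lia.
Qed.

(** For a partition, having exactly l rows, tested up to row d. *)
Definition has_length (d : nat) (p : nat -> nat) (l : nat) : Prop :=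
  forall k, k <= d -> (0 < p k) = (k < l).

(** The number of rows obeys the recursion of longest strictly increasing chains. *)
Lemma cell_has_length (d : nat) (lam mu nu rho : nat -> nat) (m l l1 l2 : nat) :
  0 < d -> at_most_rows d lam -> at_most_rows d mu -> at_most_rows d nu -> at_most_rows d rho ->
  cell d lam mu nu m rho ->
  has_length d lam l -> has_length d mu l1 -> has_length d nu l2 -> l <= l1 ->
  l1 <= d -> l2 <= d ->
  maxn (maxn l1 l2) (l + (0 < m)) <= d /\
  has_length d rho (maxn (maxn l1 l2) (l + (0 < m))).
Proof.
move=> d0 sl sm sn sr c hl h1 h2 ll1 l1d l2d.
have pos k : k <= d -> _ := cell_positive sl sm sn sr c (k := k).
split; last by move=> k kd; rewrite pos // h1 // h2 // hl; lia.
have := pos d (leqnn d); rewrite sr //= => /esym/negbT.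
by rewrite !negb_or => /and3P[_ _]; rewrite negb_and negb_or hl ?leq_pred //; lia.
Qed.

(** * Growth diagrams *)

(** Filling the quarter plane from its borders u and v by a local rule f that
    receives the values at the three earlier corners of a cell. *)
Fixpoint grid (T : Type) (f : nat -> nat -> T -> T -> T -> T) (u v : nat -> T)
    (i : nat) : nat -> T :=
  if i is i'.+1 then
    fix row (j : nat) : T :=
      if j is j'.+1 then f i' j' (grid f u v i' j') (grid f u v i' j) (row j')
      else v i
  else u.

(** The length of a longest chain of positive entries, increasing strictly in both
    coordinates, in the first i rows and j columns. *)
Definition chain_length (m : nat -> nat -> nat) : nat -> nat -> nat :=
  grid (fun i j a b c => maxn (maxn b c) (a + (0 < m i j)))
    (fun=> 0) (fun=> 0).

Lemma chain_lengthS (m : nat -> nat -> nat) (i j : nat) :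
  chain_length m i.+1 j.+1 =
  maxn (maxn (chain_length m i j.+1) (chain_length m i.+1 j))
    (chain_length m i j + (0 < m i j)).
Proof. by []. Qed.

Lemma chain_length0 (m : nat -> nat -> nat) (i : nat) : chain_length m i 0 = 0.
Proof. by case: i. Qed.

Lemma chain_length_leSr (m : nat -> nat -> nat) (i j : nat) :
  chain_length m i j <= chain_length m i j.+1.
Proof. by case: i => [//|i]; rewrite chain_lengthS; lia. Qed.

Lemma chain_length_leSl (m : nat -> nat -> nat) (i j : nat) :
  chain_length m i j <= chain_length m i.+1 j.
Proof. by case: j => [|j]; rewrite ?chain_length0 // chain_lengthS; lia. Qed.

Lemma chain_length_le (m : nat -> nat -> nat) (i j i' j' : nat) :
  i <= i' -> j <= j' -> chain_length m i j <= chain_length m i' j'.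
Proof.
move=> ii jj; apply: (@leq_trans (chain_length m i' j)).
  by apply: (homo_leq leqnn (fun _ _ _ => @leq_trans _ _ _)
    (fun k => chain_length_leSl m k j)).
by apply: (homo_leq leqnn (fun _ _ _ => @leq_trans _ _ _) (chain_length_leSr m i')).
Qed.

(** Extension by 0 to all pairs of natural numbers. *)
Definition entry (n : nat) (G : 'M[nat]_n) (i j : nat) : nat :=
  if (insub i : option 'I_n, insub j : option 'I_n) is (Some u, Some v)
  then G u v else 0.

Lemma entryE (n : nat) (G : 'M[nat]_n) (u v : 'I_n) : entry G u v = G u v.
Proof. by rewrite /entry !valK. Qed.

(** Noncrossing edges have distinct end vertices, so the matching condition is
    implied. *)
Lemma planar_matchingP (n : nat) (G : 'M[nat]_n) (S : {set 'I_n * 'I_n}) :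
  reflect ((forall e, e \in S -> 0 < G e.1 e.2) /\
           (forall e f, e \in S -> f \in S -> e != f -> noncrossing e f))
    (planar_matching G S).
Proof.
apply: (iffP idP) => [/andP[/andP[/forall_inP pos _] /forall_inP nc]|[pos nc]].
  by split=> // e f eS fS; have /forall_inP/(_ f fS)/implyP := nc e eS.
apply/andP; split; last first.
  apply/forall_inP => e eS; apply/forall_inP => f fS; apply/implyP; exact: nc.
apply/andP; split; first exact/forall_inP.
apply/forall_inP => e eS; apply/forall_inP => f fS; apply/implyP => ef.
by have := nc e f eS fS ef; rewrite /noncrossing -!val_eqE /=; lia.
Qed.

(** An edge in the last row and an edge in the last column cross unless they
    coincide.  So the matching either avoids the last row, or avoids the last
    column, or contains the corner edge, whose removal leaves a matching in the
    smaller rectangle. *)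
Lemma planar_matching_card (n : nat) (G : 'M[nat]_n) (S : {set 'I_n * 'I_n})
    (i j : nat) :
  planar_matching G S -> (forall e, e \in S -> e.1 < i /\ e.2 < j) ->
  #|S| <= chain_length (entry G) i j.
Proof.
elim: i j S => [|i IHi] j S SP SB.
  by rewrite leqn0 cards_eq0; apply/eqP/setP => e; rewrite inE; apply/negP => /SB [].
elim: j S SP SB => [|j IHj] S SP SB.
  by rewrite leqn0 cards_eq0; apply/eqP/setP => e; rewrite inE; apply/negP => /SB [].
have /planar_matchingP [pos nc] := SP; rewrite chain_lengthS.
case: (boolP [exists e in S, (e.1 == i :> nat) && (e.2 == j :> nat)]).
  case/exists_inP => e eS /andP[/eqP ei /eqP ej].
  have := cardsD1 e S; rewrite eS => ->.
  suff : #|S :\ e| <= chain_length (entry G) i j.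
    by have := pos e eS; rewrite -entryE ei ej; lia.
  apply: IHi.
    apply/planar_matchingP; split=> [f /setD1P[_ /pos]|f f'] //.
    by move=> /setD1P[_ fS] /setD1P[_]; exact: nc.
  move=> f /setD1P[fe fS]; have := nc f e fS eS fe; have := SB f fS.
  by rewrite /noncrossing ei ej; case: (f) => f1 f2 /=; lia.
move/exists_inPn => nS.
case: (boolP [forall e in S, e.1 < i]) => [/forall_inP Si|].
  apply: leq_trans (_ : chain_length (entry G) i j.+1 <= _); last by lia.
  by apply: IHi => // e eS; have := SB e eS; have := Si e eS; lia.
case/forall_inPn => e eS ei.
apply: leq_trans (_ : chain_length (entry G) i.+1 j <= _); last by lia.
apply: IHj => // f fS; have := nS e eS; have := nS f fS; have := SB e eS; have := SB f fS.
move: ei; case: (eqVneq e f) => [<-|ef]; first by case: (e) => e1 e2 /=; lia.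
have := nc e f eS fS ef; rewrite /noncrossing.
by case: (e) => e1 e2; case: (f) => f1 f2 /=; lia.
Qed.

Lemma exists_planar_matching (n : nat) (G : 'M[nat]_n) (i j : nat) :
  i <= n -> j <= n ->
  exists S : {set 'I_n * 'I_n},
    [/\ planar_matching G S, forall e, e \in S -> e.1 < i /\ e.2 < j &
        #|S| = chain_length (entry G) i j].
Proof.
have S0 : exists S : {set 'I_n * 'I_n},
    [/\ planar_matching G S, forall e, e \in S -> False & #|S| = 0].
  exists set0; split=> [|e|]; rewrite ?cards0 ?inE //.
  by apply/planar_matchingP; split=> [e|e f]; rewrite inE.
elim: i j => [|i IHi] j ni nj.
  by have [S [SP SF Sc]] := S0; exists S; split=> // e /SF.
elim: j nj => [|j IHj] nj.
  by have [S [SP SF Sc]] := S0; exists S; split=> // e /SF.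
have [S1 [P1 B1 C1]] := IHi j.+1 (ltnW ni) nj.
have [S2 [P2 B2 C2]] := IHj (ltnW nj).
have [S3 [P3 B3 C3]] := IHi j (ltnW ni) (ltnW nj).
have L01 := chain_length_leSr (entry G) i j.
rewrite chain_lengthS -C1 -C2 -C3; rewrite -C1 -C3 in L01.
have [c1|c1] := boolP ((#|S2| <= #|S1|) && (#|S3| + (0 < entry G i j) <= #|S1|)).
  exists S1; split=> //; last by lia.
  by case=> e1 e2 /B1 /=; lia.
have [c2|c2] := leqP (#|S3| + (0 < entry G i j)) #|S2|.
  exists S2; split=> //; last by lia.
  by case=> e1 e2 /B2 /=; lia.
have eG : 0 < entry G i j by lia.
pose e := (Ordinal ni, Ordinal nj) : 'I_n * 'I_n.
have eS3 : e \notin S3 by apply/negP => /B3 /=; lia.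
exists (e |: S3); split; last by rewrite cardsU1 eS3; lia.
  have /planar_matchingP [pos nc] := P3; apply/planar_matchingP; split.
    by move=> f /setU1P[->|/pos //]; rewrite -entryE.
  move=> f f' /setU1P[->|fS] /setU1P[->|fS']; rewrite ?eqxx //; last exact: nc.
    by have [? ?] := B3 _ fS' => _; apply/orP; right; apply/andP.
  by have [? ?] := B3 _ fS => _; apply/orP; left; apply/andP.
by move=> f /setU1P[-> /=|/B3 [? ?]]; split=> //; exact: leqW.
Qed.

Lemma planar_matchings_leE (n d : nat) (G : 'M[nat]_n) :
  planar_matchings_le d G = (chain_length (entry G) n n <= d).
Proof.
apply/forallP/idP => [H|le S].
  have [S [SP _ <-]] := exists_planar_matching G (leqnn n) (leqnn n).
  exact: (implyP (H S)).
by apply/implyP => SP; apply: leq_trans (planar_matching_card SP _) le => e _; split.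
Qed.

Definition growth (d n : nat) (m : nat -> nat -> nat) (G : nat -> nat -> nat -> nat) :
    Prop :=
  [/\ forall i j, i <= n -> j <= n -> at_most_rows d (G i j),
      forall j, j <= n -> G 0 j =1 (fun=> 0),
      forall i, i <= n -> G i 0 =1 (fun=> 0) &
      forall i j, i < n -> j < n ->
        cell d (G i j) (G i j.+1) (G i.+1 j) (m i j) (G i.+1 j.+1)].

Lemma growth_sym (d n : nat) (m : nat -> nat -> nat) (G : nat -> nat -> nat -> nat) :
  growth d n m G -> growth d n (fun i j => m j i) (fun i j => G j i).
Proof.
case=> sG G0 G0' cG; split=> [i j ni nj|j|i|i j ni nj]; last exact/cell_sym/cG.
- exact: sG.
- exact: G0'.
exact: G0.
Qed.

Lemma growth_strip (d n : nat) (m : nat -> nat -> nat) (G : nat -> nat -> nat -> nat)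
    (i j : nat) :
  growth d n m G -> i < n -> j <= n -> strip (G i j) (G i.+1 j).
Proof.
case=> sG G0 G0' cG ni; case: j => [|j] nj.
  by move=> k; rewrite !G0' // ltnW.
by have [] := cell_strips _ _ _ _ (cG i j ni nj); do ?[apply: sG; lia].
Qed.

(** Boundary sizes record the row sums of the matrix; by [growth_sym] they record
    its column sums on the other boundary. *)
Lemma growth_size (d n : nat) (m : nat -> nat -> nat) (G : nat -> nat -> nat -> nat)
    (i j : nat) :
  growth d n m G -> i < n -> j <= n ->
  \sum_(k < d) G i.+1 j k = \sum_(k < d) G i j k + \sum_(l < j) m i l.
Proof.
case=> sG G0 G0' cG ni; elim: j => [|j IH] nj.
  rewrite big_ord0 addn0; apply: eq_bigr => k _.
  by rewrite !G0' // ltnW.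
have := cell_size _ _ _ (cG i j ni nj); rewrite IH ?(ltnW nj) // big_ord_recr /=.
move=> H; have {}H := H (sG _ _ _ _) (sG _ _ _ _) (sG _ _ _ _).
apply/eqP; rewrite -(eqn_add2l (\sum_(k < d) G i j k)); apply/eqP.
by rewrite H ?(ltnW ni) ?(ltnW nj) // -!addnA addnCA.
Qed.

(** The longest chain and the number of rows satisfy the same recursion, see
    [cell_has_length]. *)
Lemma growth_chain_length (d n : nat) (m : nat -> nat -> nat)
    (G : nat -> nat -> nat -> nat) (i j : nat) :
  0 < d -> growth d n m G -> i <= n -> j <= n ->
  chain_length m i j <= d /\ has_length d (G i j) (chain_length m i j).
Proof.
move=> d0 [sG G0 G0' cG]; elim: i j => [|i IHi] j ni nj.
  by split=> // k _; rewrite G0.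
elim: j nj => [|j IHj] nj.
  by rewrite chain_length0; split=> // k _; rewrite G0'.
have [l1 h1] := IHi j.+1 (ltnW ni) nj; have [l2 h2] := IHj (ltnW nj).
have [l3 h3] := IHi j (ltnW ni) (ltnW nj).
rewrite chain_lengthS; apply: (cell_has_length d0 _ _ _ _ (cG i j ni nj) h3 h1 h2 _ l1 l2).
- exact: sG (ltnW ni) (ltnW nj).
- exact: sG (ltnW ni) nj.
- exact: sG ni (ltnW nj).
- exact: sG ni nj.
exact: chain_length_leSr.
Qed.

Lemma growth_forward_unique (d n : nat) (m m' : nat -> nat -> nat)
    (G G' : nat -> nat -> nat -> nat) (i j : nat) :
  growth d n m G -> growth d n m' G' ->
  (forall i j, i < n -> j < n -> m i j = m' i j) ->
  i <= n -> j <= n -> G i j =1 G' i j.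
Proof.
case=> sG G0 G0' cG [sG' H0 H0' cG'] mE; elim: i j => [|i IHi] j ni nj.
  by move=> k; rewrite G0 ?H0.
elim: j nj => [|j IHj] nj; first by move=> k; rewrite G0' ?H0'.
have := cG i j ni nj; rewrite mE // => c; have := cG' i j ni nj.
apply: (cell_forward_unique (sG _ _ ni nj) (sG' _ _ ni nj) _ _ _ c).
- exact: IHi (ltnW ni) (ltnW nj).
- exact: IHi (ltnW ni) nj.
exact: IHj (ltnW nj).
Qed.

Lemma growth_backward_unique (d n : nat) (m m' : nat -> nat -> nat)
    (G G' : nat -> nat -> nat -> nat) :
  growth d n m G -> growth d n m' G' ->
  (forall i, i <= n -> G i n =1 G' i n) -> (forall j, j <= n -> G n j =1 G' n j) ->
  forall i j, i < n -> j < n -> m i j = m' i j.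
Proof.
case=> sG _ _ cG [sG' _ _ cG'] En nE.
have step i j : i < n -> j < n -> G i.+1 j.+1 =1 G' i.+1 j.+1 ->
    G i j.+1 =1 G' i j.+1 -> G i.+1 j =1 G' i.+1 j ->
    G i j =1 G' i j /\ m i j = m' i j.
  move=> ni nj e1 e2 e3.
  exact: (cell_backward_unique (sG _ _ (ltnW ni) (ltnW nj)) (sG' _ _ (ltnW ni) (ltnW nj))
    e1 e2 e3 (cG i j ni nj) (cG' i j ni nj)).
have E a b : a <= n -> b <= n -> G (n - a) (n - b) =1 G' (n - a) (n - b).
  elim: a b => [|a IHa] b na nb; first by rewrite subn0; apply: nE; exact: leq_subr.
  elim: b nb => [|b IHb] nb; first by rewrite subn0; apply: En; exact: leq_subr.
  have aE : (n - a.+1).+1 = n - a by lia.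
  have bE : (n - b.+1).+1 = n - b by lia.
  have [|||||//] := step (n - a.+1) (n - b.+1); rewrite ?aE ?bE; try lia.
  - exact: IHa (ltnW na) (ltnW nb).
  - exact: IHb (ltnW nb).
  exact: IHa (ltnW na) nb.
have E' i j : i <= n -> j <= n -> G i j =1 G' i j.
  by move=> ni nj; rewrite -(subKn ni) -(subKn nj); apply: E; exact: leq_subr.
move=> i j ni nj.
by have [|||_ //] := step i j ni nj; apply: E'; rewrite // ltnW.
Qed.

Definition forward_growth (d : nat) (m : nat -> nat -> nat) :
    nat -> nat -> nat -> nat :=
  grid (fun i j lam mu nu => forward d lam mu nu (m i j)) (fun _ _ => 0) (fun _ _ => 0).

(** The hypothesis of [forward_cell] holds at every cell because chain lengths,
    which are the numbers of rows already built, never exceed d. *)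
Lemma forward_growthP (d n : nat) (m : nat -> nat -> nat) :
  0 < d -> chain_length m n n <= d -> growth d n m (forward_growth d m).
Proof.
move=> d0 Ld; set G := forward_growth d m.
have G0' i : G i 0 = (fun=> 0) by case: i.
have L_le i j : i <= n -> j <= n -> chain_length m i j <= d.
  by move=> ni nj; apply: leq_trans Ld; exact: chain_length_le.
pose ok i j := at_most_rows d (G i j) /\ has_length d (G i j) (chain_length m i j).
have row i : (forall j, j <= n -> ok i j) /\
    (forall j, j < n -> strip (G i j) (G i j.+1)) ->
  i < n ->
  ((forall j, j <= n -> ok i.+1 j) /\
   (forall j, j < n -> strip (G i.+1 j) (G i.+1 j.+1))) /\
  (forall j, j < n -> cell d (G i j) (G i j.+1) (G i.+1 j) (m i j) (G i.+1 j.+1)).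
  move=> [okG stG] ni.
  have H j : j < n -> ok i.+1 j -> strip (G i j) (G i.+1 j) ->
      [/\ ok i.+1 j.+1, strip (G i j.+1) (G i.+1 j.+1),
          strip (G i.+1 j) (G i.+1 j.+1) &
          cell d (G i j) (G i j.+1) (G i.+1 j) (m i j) (G i.+1 j.+1)].
    move=> nj [sn ln] st; have [sl ll] := okG j (ltnW nj); have [sm lm] := okG j.+1 nj.
    have [|sr c] := forward_cell d0 sl sm sn (stG j nj) st (m := m i j).
      move=> m0; have := ll d.-1 (leq_pred d); have := L_le _ _ ni nj.
      by rewrite chain_lengthS m0; lia.
    rewrite -/(G i.+1 j.+1) in sr c.
    have [_ _ st1 st2] := cell_strips sl sm sn sr c.
    split=> //; split=> //; rewrite chain_lengthS.
    by have [] := cell_has_length d0 sl sm sn sr c ll lm ln (chain_length_leSr m i j)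
      (L_le _ _ (ltnW ni) nj) (L_le _ _ ni (ltnW nj)).
  have H' j : j <= n -> ok i.+1 j /\ strip (G i j) (G i.+1 j).
    elim: j => [|j IHj] nj; last first.
      by have [h1 h2] := IHj (ltnW nj); have [] := H j nj h1 h2.
    rewrite /ok !G0'; split; last by move=> k.
    by split=> // k _; rewrite chain_length0.
  split; first split=> j nj.
  - by have [] := H' j nj.
  - by have [h1 h2] := H' j (ltnW nj); have [] := H j nj h1 h2.
  by move=> j nj; have [h1 h2] := H' j (ltnW nj); have [] := H j nj h1 h2.
have rows i : i <= n -> (forall j, j <= n -> ok i j) /\
    (forall j, j < n -> strip (G i j) (G i j.+1)).
  elim: i => [|i IHi] ni; last by have [] := row i (IHi (ltnW ni)) ni.
  by split=> j nj; [split=> // k _ | move=> k].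
split=> [i j ni nj|j nj k|i ni k|i j ni nj] //.
- by have [/(_ j nj) []] := rows i ni.
- by rewrite G0'.
by have [_] := row i (rows i (ltnW ni)) ni; exact.
Qed.

(** The grid is filled from the corner (n, n) towards (0, 0), hence the reversed
    indices; R and T prescribe the boundaries G i n and G n j. *)
Definition backward_growth (n : nat) (R T : nat -> nat -> nat) (i j : nat) :
    nat -> nat :=
  grid (fun _ _ rho nu mu => backward mu nu rho)
    (fun b => T (n - b)) (fun a => R (n - a)) (n - i) (n - j).

Definition backward_entry (d n : nat) (R T : nat -> nat -> nat) (i j : nat) : nat :=
  let G := backward_growth n R T in
  backward_carry (G i j.+1) (G i.+1 j) (G i.+1 j.+1) d.

(** Partitions shrink along the grid, so those on the sides G 0 j and G i 0 lie
    inside R 0 and T 0 and are empty. *)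
Lemma backward_growthP (d n : nat) (R T : nat -> nat -> nat) :
  R 0 =1 (fun=> 0) -> T 0 =1 (fun=> 0) -> R n = T n ->
  (forall i, i <= n -> at_most_rows d (R i)) -> (forall j, j <= n -> at_most_rows d (T j)) ->
  (forall i, i < n -> strip (R i) (R i.+1)) ->
  (forall j, j < n -> strip (T j) (T j.+1)) ->
  [/\ growth d n (backward_entry d n R T) (backward_growth n R T),
      forall i, i <= n -> backward_growth n R T i n = R i &
      forall j, j <= n -> backward_growth n R T n j = T j].
Proof.
move=> R0 T0 RT sR sT stR stT; set G := backward_growth n R T.
have Gn j : j <= n -> G n j = T j by move=> nj; rewrite /G /backward_growth subnn /= subKn.
have nG i : i <= n -> G i n = R i.
  move=> ni; rewrite /G /backward_growth subnn.
  by case E : (n - i) => [|a] /=; rewrite ?subn0 -?E ?subKn // -RT; congr R; lia.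
have Gb i j : i < n -> j < n -> G i j = backward (G i j.+1) (G i.+1 j) (G i.+1 j.+1).
  move=> ni nj; rewrite /G /backward_growth.
  have -> : n - i = (n - i.+1).+1 by lia.
  by have -> : n - j = (n - j.+1).+1 by lia.
have row i : i < n -> (forall j, j <= n -> at_most_rows d (G i.+1 j)) /\
    (forall j, j < n -> strip (G i.+1 j) (G i.+1 j.+1)) ->
  [/\ (forall j, j <= n -> at_most_rows d (G i j)) /\
      (forall j, j < n -> strip (G i j) (G i j.+1)),
      forall j, j <= n -> strip (G i j) (G i.+1 j) &
   forall j, j < n ->
     cell d (G i j) (G i j.+1) (G i.+1 j) (backward_entry d n R T i j) (G i.+1 j.+1)].
  move=> ni [sG stG].
  have H j : j < n -> at_most_rows d (G i j.+1) -> strip (G i j.+1) (G i.+1 j.+1) ->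
      [/\ at_most_rows d (G i j), strip (G i j) (G i.+1 j), strip (G i j) (G i j.+1) &
      cell d (G i j) (G i j.+1) (G i.+1 j) (backward_entry d n R T i j) (G i.+1 j.+1)].
    move=> nj sm st; have sn := sG j (ltnW nj); have sr := sG j.+1 nj.
    have [sl c] := backward_cell sm sn sr st (stG j nj).
    rewrite -Gb // in sl c.
    by have [] := cell_strips sl sm sn sr c.
  have H' b : b <= n -> at_most_rows d (G i (n - b)) /\ strip (G i (n - b)) (G i.+1 (n - b)).
    elim: b => [|b IHb] nb.
      by rewrite subn0 !nG ?(ltnW ni) //; split; [apply: sR; exact: ltnW | exact: stR].
    have bE : n - b = (n - b.+1).+1 by lia.
    have [] := IHb (ltnW nb); rewrite bE => h1 h2.
    by have [] := H (n - b.+1) _ h1 h2; first lia.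
  have {}H' j : j <= n -> at_most_rows d (G i j) /\ strip (G i j) (G i.+1 j).
    by move=> nj; rewrite -(subKn nj); apply: H'; exact: leq_subr.
  split; first split=> j nj.
  - by have [] := H' j nj.
  - by have [h1 h2] := H' j.+1 nj; have [] := H j nj h1 h2.
  - by move=> j nj; have [] := H' j nj.
  by move=> j nj; have [h1 h2] := H' j.+1 nj; have [] := H j nj h1 h2.
have rows i : i <= n -> (forall j, j <= n -> at_most_rows d (G i j)) /\
    (forall j, j < n -> strip (G i j) (G i j.+1)).
  move=> ni; rewrite -(subKn ni); elim: (n - i) (leq_subr i n) => [|a IH] na.
    rewrite subn0; split=> j nj; first by rewrite Gn //; exact: sT.
    by rewrite !Gn ?(ltnW nj) //; exact: stT.
  have aE : n - a = (n - a.+1).+1 by lia.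
  have := IH (ltnW na); rewrite aE => h.
  by have [] := row (n - a.+1) _ h; first lia.
have zero p q : strip p q -> q =1 (fun=> 0) -> p =1 (fun=> 0).
  by move=> st q0 k; have [] := st k; rewrite q0 leqn0 => /eqP.
split=> //; split=> [i j ni nj|j nj|i ni|i j ni nj].
- by have [/(_ j nj)] := rows i ni.
- rewrite -(subKn nj); elim: (n - j) (leq_subr j n) => [|b IH] nb.
    by rewrite subn0 nG.
  have bE : n - b = (n - b.+1).+1 by lia.
  have := IH (ltnW nb); rewrite bE; apply: zero.
  by have [_] := rows 0 (leq0n n); apply; lia.
- rewrite -(subKn ni); elim: (n - i) (leq_subr i n) => [|a IH] na.
    by rewrite subn0 Gn.
  have aE : n - a = (n - a.+1).+1 by lia.
  have := IH (ltnW na); rewrite aE; apply: zero.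
  have an : n - a.+1 < n by lia.
  by have [_ st _] := row (n - a.+1) an (rows _ an); exact: st.
by have [_ _] := row i ni (rows _ ni); exact.
Qed.

(** * Multigraphs and pairs of interlacing paths *)

(** Adding the staircase makes the row lengths of a partition strictly decreasing. *)
Definition config_of (d B : nat) (p : nat -> nat) : config d B :=
  [ffun i : 'I_d => inord (d.-1 - i + p i)].

Definition shape_of (d B : nat) (x : config d B) (k : nat) : nat :=
  if insub k : option 'I_d is Some i then x i - (d.-1 - i) else 0.

Lemma shape_of_ord (d B : nat) (x : config d B) (i : 'I_d) :
  shape_of x i = x i - (d.-1 - i).
Proof. by rewrite /shape_of valK. Qed.

Lemma shape_of_at_most_rows (d B : nat) (x : config d B) : at_most_rows d (shape_of x).
Proof. by move=> k dk; rewrite /shape_of insubN // -leqNgt. Qed.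

Lemma config_ofE (d B : nat) (p : nat -> nat) (i : 'I_d) :
  d.-1 + p i <= B -> config_of d B p i = d.-1 - i + p i :> nat.
Proof. by move=> pB; rewrite ffunE inordK //; lia. Qed.

Lemma shape_of_config_of (d B : nat) (p : nat -> nat) :
  at_most_rows d p -> (forall k, d.-1 + p k <= B) -> shape_of (config_of d B p) =1 p.
Proof.
move=> sp pB k; have [dk|kd] := leqP d k; first by rewrite shape_of_at_most_rows ?sp.
by rewrite -[k]/(val (Ordinal kd)) shape_of_ord config_ofE //= addKn.
Qed.

(** Strictly decreasing natural numbers dominate the staircase, so subtracting it
    in [shape_of] never truncates. *)
Lemma decreasing_ge (d B : nat) (x : config d B) (i : 'I_d) :
  decreasing x -> d.-1 - i <= x i.
Proof.
move=> xd; move: {2}(d.-1 - i) (erefl (d.-1 - i)) => t.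
elim: t i => [|t IH] i it; first by rewrite it.
have id : i.+1 < d by lia.
have := IH (Ordinal id) _; rewrite /= => /(_ ltac:(lia)).
by have /forallP/(_ i)/forallP/(_ (Ordinal id))/implyP/(_ (leqnn _)) := xd; lia.
Qed.

Lemma shape_of_inj (d B : nat) (x y : config d B) :
  decreasing x -> decreasing y -> shape_of x =1 shape_of y -> x = y.
Proof.
move=> xd yd e; apply/ffunP => i; apply: val_inj => /=.
have := e i; rewrite !shape_of_ord.
by have := decreasing_ge i xd; have := decreasing_ge i yd; lia.
Qed.

(** With the staircase added, the weak inequalities of a horizontal strip become
    the strict inequalities of interlacing. *)
Lemma interlaced_config_of (r d B : nat) (p q : nat -> nat) :
  strip p q -> \sum_(k < d) q k = \sum_(k < d) p k + r ->
  (forall k, d.-1 + q k <= B) ->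
  interlaced r (config_of d B p) (config_of d B q).
Proof.
move=> st sz qB; have pB k : d.-1 + p k <= B by have [? _] := st k; have := qB k; lia.
apply/andP; split; first (apply/andP; split).
- by apply/forallP => i; rewrite !config_ofE //; have [? _] := st i; lia.
- under eq_bigr => i _ do rewrite config_ofE //.
  under [X in _ == X + _]eq_bigr => i _ do rewrite config_ofE //.
  by rewrite !big_split /= sz addnA.
apply/forallP => i; apply/forallP => j; apply/implyP => /andP[/eqP ji _].
rewrite !config_ofE // ji; have [_ ?] := st i; have := ltn_ord j; lia.
Qed.

Lemma interlaced_shape_of (r d B : nat) (z x : config d B) :
  decreasing z -> interlaced r z x ->
  strip (shape_of z) (shape_of x) /\
  \sum_(k < d) shape_of x k = \sum_(k < d) shape_of z k + r.
Proof.
move=> zd /andP[/andP[/forallP zx /eqP sz] /forallP zi].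
split=> [k|].
  have [dk|kd] := leqP d k; first by rewrite !shape_of_at_most_rows // leqW.
  rewrite -[k]/(val (Ordinal kd)) !shape_of_ord /=.
  split; first by have := zx (Ordinal kd); lia.
  have [dk1|k1d] := leqP d k.+1; first by rewrite shape_of_at_most_rows.
  rewrite -[k.+1]/(val (Ordinal k1d)) !shape_of_ord /=.
  have /forallP/(_ (Ordinal k1d))/implyP := zi (Ordinal kd).
  by rewrite /= eqxx kd => /(_ erefl); lia.
apply/eqP; rewrite -(eqn_add2l (\sum_(i < d) (d.-1 - i))) addnA -!big_split /=.
apply/eqP; transitivity (\sum_(i < d) (x i : nat)).
  apply: eq_bigr => i _; rewrite shape_of_ord subnKC //.
  exact: leq_trans (decreasing_ge i zd) (zx i).
rewrite sz; congr (_ + r); apply: eq_bigr => i _; rewrite shape_of_ord subnKC //.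
exact: decreasing_ge.
Qed.

Lemma shape_of_staircase (d B : nat) : d <= B -> shape_of (staircase d B) =1 (fun=> 0).
Proof.
move=> dB k; have [dk|kd] := leqP d k; first by rewrite shape_of_at_most_rows.
by rewrite -[k]/(val (Ordinal kd)) shape_of_ord staircaseE // subnn.
Qed.

Definition chain_tuple (d B n : nat) (Q : nat -> nat -> nat) : n.-tuple (config d B) :=
  [tuple config_of d B (Q i.+1) | i < n].

Lemma nth_chain_tuple (d B n : nat) (Q : nat -> nat -> nat) (i : nat) :
  Q 0 =1 (fun=> 0) -> i <= n ->
  nth (staircase d B) (staircase d B :: chain_tuple d B n Q) i = config_of d B (Q i).
Proof.
move=> Q0; case: i => [|i] ni /=.
  by apply/ffunP => k; rewrite !ffunE Q0 addn0.
by rewrite -[i]/(val (Ordinal ni)) nth_mktuple.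
Qed.

Lemma chain_tuple_path (r d B n : nat) (Q : nat -> nat -> nat) :
  Q 0 =1 (fun=> 0) -> (forall i, i < n -> strip (Q i) (Q i.+1)) ->
  (forall i, i <= n -> \sum_(k < d) Q i k = r * i) ->
  (forall i k, i <= n -> d.-1 + Q i k <= B) ->
  path (@interlaced r d B) (staircase d B) (chain_tuple d B n Q) /\
  last (staircase d B) (chain_tuple d B n Q) = config_of d B (Q n).
Proof.
move=> Q0 st sz QB; split; last first.
  by rewrite (last_nth (staircase d B)) size_tuple nth_chain_tuple.
apply/(pathP (staircase d B)) => i; rewrite size_tuple => ni.
rewrite -[nth _ (val _) i]/(nth (staircase d B) (staircase d B :: _) i.+1).
rewrite !nth_chain_tuple // ?(ltnW ni) //; apply: interlaced_config_of.
- exact: st.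
- by rewrite !sz ?(ltnW ni) // mulnS addnC.
by move=> k; exact: QB.
Qed.

Definition tuple_chain (d B : nat) (t : seq (config d B)) (i : nat) : nat -> nat :=
  shape_of (nth (staircase d B) (staircase d B :: t) i).

Lemma tuple_chain_decreasing (r d B n : nat) (t : n.-tuple (config d B)) (i : nat) :
  d <= B -> path (@interlaced r d B) (staircase d B) t -> i <= n ->
  decreasing (nth (staircase d B) (staircase d B :: t) i).
Proof.
move=> dB /(pathP (staircase d B)) pt; case: i => [|i] ni.
  exact: staircase_decreasing.
by have := pt i; rewrite size_tuple => /(_ ni) /interlaced_decreasing_next.
Qed.

Lemma tuple_chain_step (r d B n : nat) (t : n.-tuple (config d B)) (i : nat) :
  d <= B -> path (@interlaced r d B) (staircase d B) t -> i < n ->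
  strip (tuple_chain t i) (tuple_chain t i.+1) /\
  \sum_(k < d) tuple_chain t i.+1 k = \sum_(k < d) tuple_chain t i k + r.
Proof.
move=> dB pt ni; have dec := tuple_chain_decreasing dB pt (ltnW ni).
have /(pathP (staircase d B))/(_ i) := pt; rewrite size_tuple => /(_ ni).
exact: interlaced_shape_of.
Qed.

Lemma tuple_chain_inj (r d B n : nat) (s t : n.-tuple (config d B)) :
  d <= B -> path (@interlaced r d B) (staircase d B) s ->
  path (@interlaced r d B) (staircase d B) t ->
  (forall i, i <= n -> tuple_chain s i =1 tuple_chain t i) -> s = t.
Proof.
move=> dB ps pt e; apply: val_inj; apply: (@eq_from_nth _ (staircase d B)).
  by rewrite !size_tuple.
move=> i; rewrite size_tuple => ni; apply: shape_of_inj.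
- exact: (tuple_chain_decreasing (i := i.+1) dB ps ni).
- exact: (tuple_chain_decreasing (i := i.+1) dB pt ni).
exact: (e i.+1 ni).
Qed.

Lemma growth_row_size (r d n : nat) (m : nat -> nat -> nat)
    (G : nat -> nat -> nat -> nat) (i : nat) :
  growth d n m G -> (forall i, i < n -> \sum_(l < n) m i l = r) -> i <= n ->
  \sum_(k < d) G i n k = r * i.
Proof.
move=> gG mr; elim: i => [|i IH] ni.
  by case: gG => _ G0 _ _; rewrite muln0 big1 // => k _; rewrite G0.
by rewrite (growth_size gG ni (leqnn n)) IH ?(ltnW ni) // mr // mulnS addnC.
Qed.

Lemma growth_row_bound (r d B n : nat) (m : nat -> nat -> nat)
    (G : nat -> nat -> nat -> nat) (i k : nat) :
  d + r * n <= B ->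
  growth d n m G -> (forall i, i < n -> \sum_(l < n) m i l = r) -> i <= n ->
  d.-1 + G i n k <= B.
Proof.
move=> dB gG mr ni; have [dk|kd] := leqP d k.
  by case: gG => sG _ _ _; rewrite sG //; lia.
have := growth_row_size gG mr ni; rewrite (bigD1 (Ordinal kd)) //= => e.
have : r * i <= r * n by rewrite leq_mul2l ni orbT.
lia.
Qed.

(** Stated for the boundary G i n; the boundary G n j is the same statement for
    the transposed diagram. *)
Lemma growth_row_path (r d B n : nat) (m : nat -> nat -> nat)
    (G : nat -> nat -> nat -> nat) :
  d + r * n <= B ->
  growth d n m G -> (forall i, i < n -> \sum_(l < n) m i l = r) ->
  path (@interlaced r d B) (staircase d B) (chain_tuple d B n (fun i => G i n)) /\
  last (staircase d B) (chain_tuple d B n (fun i => G i n)) = config_of d B (G n n).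
Proof.
move=> dB gG mr; apply: (@chain_tuple_path r d B n (fun i => G i n)).
- by case: gG => _ G0 _ _; exact: G0.
- by move=> i ni; exact: (growth_strip gG).
- by move=> i; exact: (growth_row_size gG).
by move=> i k; exact: (growth_row_bound _ dB gG).
Qed.

Lemma growth_row_determined (r d B n : nat) (m m' : nat -> nat -> nat)
    (G G' : nat -> nat -> nat -> nat) (i : nat) :
  d + r * n <= B -> growth d n m G -> growth d n m' G' ->
  (forall i, i < n -> \sum_(l < n) m i l = r) ->
  (forall i, i < n -> \sum_(l < n) m' i l = r) ->
  chain_tuple d B n (fun i => G i n) = chain_tuple d B n (fun i => G' i n) ->
  i <= n -> G i n =1 G' i n.
Proof.
move=> dB gG gG' mr mr' e ni.
have [[sG G0 _ _] [sG' G0' _ _]] := (gG, gG').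
have := congr1 (fun t : n.-tuple _ =>
  nth (staircase d B) (staircase d B :: t) i) e.
rewrite (@nth_chain_tuple d B n (fun i => G i n)) //; last exact: G0.
rewrite (@nth_chain_tuple d B n (fun i => G' i n)) //; last exact: G0'.
move=> E k; rewrite -(shape_of_config_of (sG i n ni (leqnn n))
  (fun k => growth_row_bound k dB gG mr ni)) E.
by rewrite (shape_of_config_of (sG' i n ni (leqnn n))
  (fun k => growth_row_bound k dB gG' mr' ni)).
Qed.

Definition path_pairs (r n d B : nat) :
    {set n.-tuple (config d B) * n.-tuple (config d B)} :=
  [set p : n.-tuple (config d B) * n.-tuple (config d B) |
     [&& path (@interlaced r d B) (staircase d B) p.1,
               path (@interlaced r d B) (staircase d B) p.2 &
               last (staircase d B) p.1 == last (staircase d B) p.2]].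

Lemma card_path_pairs (r n d B : nat) :
  #|path_pairs r n d B| =
  \sum_(x : config d B) npaths (@interlaced r d B) n (staircase d B) x ^ 2.
Proof.
pose c := staircase d B.
rewrite -sum1_card (partition_big (fun p => last c (val p.1)) xpredT) //=.
apply: eq_bigr => x _; rewrite npaths_card -mulnn -cardsX -sum1_card.
apply: eq_bigl => -[s t]; rewrite !inE /= -/c.
case: (last c s =P x) => [<-|_]; last by rewrite !andbF.
by rewrite !andbT eq_sym.
Qed.

Lemma regular_rows (n r : nat) (G : 'M[nat]_n) (i : nat) :
  regular r G -> i < n -> \sum_(l < n) entry G i l = r.
Proof.
case/andP => /forallP H _ ni; rewrite -(eqP (H (Ordinal ni))).
by apply: eq_bigr => l _; rewrite -[i]/(val (Ordinal ni)) entryE.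
Qed.

Lemma regular_columns (n r : nat) (G : 'M[nat]_n) (j : nat) :
  regular r G -> j < n -> \sum_(l < n) entry G l j = r.
Proof.
case/andP => _ /forallP H nj; rewrite -(eqP (H (Ordinal nj))).
by apply: eq_bigr => l _; rewrite -[j]/(val (Ordinal nj)) entryE.
Qed.

Definition bounded_entry (r n : nat) (M : 'M['I_r.+1]_n) : nat -> nat -> nat :=
  entry (map_mx (@nat_of_ord r.+1) M).

Definition good_graphs (r n d : nat) : {set 'M['I_r.+1]_n} :=
  [set G : 'M['I_r.+1]_n |
      let G' := map_mx (@nat_of_ord r.+1) G in
      regular r G' && planar_matchings_le d G'].

Lemma good_graphs_growth (r n d : nat) (M : 'M['I_r.+1]_n) :
  0 < d -> M \in good_graphs r n d ->
  [/\ growth d n (bounded_entry M) (forward_growth d (bounded_entry M)),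
      forall i, i < n -> \sum_(l < n) bounded_entry M i l = r &
      forall j, j < n -> \sum_(l < n) bounded_entry M l j = r].
Proof.
move=> d0; rewrite inE /= planar_matchings_leE => /andP[reg Ld].
split; first exact: forward_growthP.
  by move=> i; exact: regular_rows.
by move=> j; exact: regular_columns.
Qed.

Lemma bounded_entry_inj (r n : nat) (M N : 'M['I_r.+1]_n) :
  (forall i j, i < n -> j < n -> bounded_entry M i j = bounded_entry N i j) -> M = N.
Proof.
move=> e; apply/matrixP => i j; apply: val_inj.
by have := e i j (ltn_ord i) (ltn_ord j); rewrite /bounded_entry !entryE !mxE.
Qed.

(** The two boundaries of its growth diagram determine the multigraph, by running
    the local rule backwards. *)
Lemma leq_good_graphs (r n d B : nat) :
  0 < d -> d + r * n <= B -> #|good_graphs r n d| <= #|path_pairs r n d B|.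
Proof.
move=> d0 dB.
pose G (M : 'M['I_r.+1]_n) := forward_growth d (bounded_entry M).
pose f (M : 'M['I_r.+1]_n) :=
  (chain_tuple d B n (fun i => G M i n), chain_tuple d B n (fun j => G M n j)).
rewrite -(@card_in_imset _ _ f) => [|M N MA NA e].
  apply/subset_leq_card/subsetP => _ /imsetP[M MA ->].
  have [gG rows cols] := good_graphs_growth d0 MA.
  have [p1 l1] := growth_row_path dB gG rows.
  have [p2 l2] := growth_row_path dB (growth_sym gG) cols.
  by rewrite inE /= p1 p2 l1 l2 eqxx.
have [gM rM cM] := good_graphs_growth d0 MA.
have [gN rN cN] := good_graphs_growth d0 NA.
apply: bounded_entry_inj; apply: (growth_backward_unique gM gN) => i ni.
  exact: (growth_row_determined dB gM gN rM rN (congr1 fst e)).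
exact: (growth_row_determined dB (growth_sym gM) (growth_sym gN) cM cN (congr1 snd e)).
Qed.

Lemma growth_ext (d n : nat) (m m' : nat -> nat -> nat) (G : nat -> nat -> nat -> nat) :
  (forall i j, i < n -> j < n -> m i j = m' i j) -> growth d n m G -> growth d n m' G.
Proof.
by move=> e [sG G0 G0' cG]; split=> // i j ni nj; rewrite -e //; exact: cG.
Qed.

Definition graph_of_paths (r n d B : nat)
    (p : n.-tuple (config d B) * n.-tuple (config d B)) : 'M['I_r.+1]_n :=
  \matrix_(i, j) inord (backward_entry d n (tuple_chain p.1) (tuple_chain p.2) i j).

(** Filling the grid backwards from a pair of paths recovers a regular multigraph;
    the diagram lives in partitions with at most d rows, which bounds its planar
    matchings by [growth_chain_length]. *)
Lemma path_pairs_growth (r n d B : nat)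
    (p : n.-tuple (config d B) * n.-tuple (config d B)) :
  0 < d -> d <= B -> p \in path_pairs r n d B ->
  exists G, [/\ growth d n (bounded_entry (graph_of_paths r p)) G,
    forall i, i <= n -> G i n = tuple_chain p.1 i,
    forall j, j <= n -> G n j = tuple_chain p.2 j &
    graph_of_paths r p \in good_graphs r n d].
Proof.
move=> d0 dB; case: p => s t; rewrite inE /= => /and3P[ps pt /eqP st].
set R := tuple_chain s; set T := tuple_chain t.
have lastE (u : n.-tuple (config d B)) :
    last (staircase d B) u = nth (staircase d B) (staircase d B :: u) n.
  by rewrite (last_nth (staircase d B)) size_tuple.
have RT : R n = T n by rewrite /R /T /tuple_chain -!lastE st.
have [gG GR GT] := @backward_growthP d n R T (shape_of_staircase dB)
  (shape_of_staircase dB) RT (fun _ _ => @shape_of_at_most_rows _ _ _)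
  (fun _ _ => @shape_of_at_most_rows _ _ _)
  (fun i ni => (tuple_chain_step dB ps ni).1) (fun i ni => (tuple_chain_step dB pt ni).1).
set m := backward_entry d n R T in gG.
have rows i : i < n -> \sum_(l < n) m i l = r.
  move=> ni; have := growth_size gG ni (leqnn n); rewrite !GR ?(ltnW ni) //.
  by have [_ ->] := tuple_chain_step dB ps ni => /addnI.
have cols j : j < n -> \sum_(l < n) m l j = r.
  move=> nj; have := growth_size (growth_sym gG) nj (leqnn n); rewrite !GT ?(ltnW nj) //.
  by have [_ ->] := tuple_chain_step dB pt nj => /addnI.
have mr i j : i < n -> j < n -> m i j <= r.
  by move=> ni nj; rewrite -(rows i ni) (bigD1 (Ordinal nj)) //= leq_addr.
set M := graph_of_paths r (s, t).
have ME i j : i < n -> j < n -> m i j = bounded_entry M i j.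
  move=> ni nj; rewrite /bounded_entry -[i]/(val (Ordinal ni)) -[j]/(val (Ordinal nj)).
  by rewrite entryE !mxE inordK //= ltnS mr.
have {}gG := growth_ext ME gG.
exists (backward_growth n R T); split=> //; rewrite inE.
have [Ld _] := growth_chain_length d0 gG (leqnn n) (leqnn n).
rewrite /= planar_matchings_leE Ld andbT; apply/andP; split; apply/forallP => u.
  rewrite -[X in _ == X](rows u (ltn_ord u)); apply/eqP/eq_bigr => l _.
  by rewrite ME // /bounded_entry entryE.
rewrite -[X in _ == X](cols u (ltn_ord u)); apply/eqP/eq_bigr => l _.
by rewrite ME // /bounded_entry entryE.
Qed.

(** The multigraph determines its growth diagram, hence the boundaries, by running
    the local rule forwards. *)
Lemma leq_path_pairs (r n d B : nat) :
  0 < d -> d <= B -> #|path_pairs r n d B| <= #|good_graphs r n d|.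
Proof.
move=> d0 dB; rewrite -(@card_in_imset _ _ (@graph_of_paths r n d B)).
  apply/subset_leq_card/subsetP => _ /imsetP[p pP ->].
  by have [G []] := path_pairs_growth d0 dB pP.
move=> p q pP qP e.
have [G [gG GR GT _]] := path_pairs_growth d0 dB pP.
have [H [gH HR HT _]] := path_pairs_growth d0 dB qP.
have E i j : i <= n -> j <= n -> G i j =1 H i j.
  by apply: (growth_forward_unique gG gH) => k l _ _; rewrite e.
move: pP qP; rewrite !inE => /and3P[p1 p2 _] /and3P[q1 q2 _].
rewrite [p]surjective_pairing [q]surjective_pairing; congr pair.
  by apply: (tuple_chain_inj dB p1 q1) => i ni; rewrite -GR // -HR //; exact: E.
by apply: (tuple_chain_inj dB p2 q2) => i ni; rewrite -GT // -HT //; exact: E.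
Qed.

Lemma g_npaths (r n d B : nat) :
  0 < d -> d + r * n <= B ->
  g r n d = \sum_(x : config d B) npaths (@interlaced r d B) n (staircase d B) x ^ 2.
Proof.
move=> d0 dB; rewrite -card_path_pairs; apply/eqP.
rewrite eqn_leq (leq_good_graphs d0 dB) leq_path_pairs //; lia.
Qed.

Theorem theorem1 (n d r : nat) (hn : 0 < n) (hd : 0 < d) (hr : 0 < r) :
  ((g r n d)%:Z =
    \sum_(pi : 'S_d) (-1) ^+ odd_perm pi * (#|Wprime r n pi|)%:Z)%R.
Proof.
pose B := d + r * n; have dB : d <= B by exact: leq_addr.
rewrite (g_npaths hd (leqnn B)) -(sum_signed_paths r n dB) /signed_paths.
under eq_bigr do rewrite big_distrr /=.
rewrite exchange_big /=; apply: eq_bigr => s _.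
rewrite (card_Wprime_paths s (leqnn B)) (big_morph _ PoszD (erefl _)) big_distrr /=.
by apply: eq_bigr => x _; rewrite PoszM mulrCA.
Qed.
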